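(* Let $X$ be either (a) a scaled Brownian motion $\sigma W$ with $\sigma>0$, or (b) the Ornstein--Uhlenbeck process $\mathrm{d}X_t=-\theta X_t\,\mathrm{d}t+\sigma\,\mathrm{d}W_t$ with $\theta,\sigma>0$; in either case $X_0=x_0$ and the target is the bridge law on $[0,T]$ conditioned on $X_T=x_T$. Let $C_{\mathrm{rej}}:(0,\infty)\to(0,\infty)$ be the expected-cost function of the bridge sampler used inside each Gibbs step, and assume there are constants $K,t_0>0$ with $C_{\mathrm{rej}}(t)\le Kt$ for all $0<t\le t_0$; in case (a) assume $C_{\mathrm{rej}}(t)=c_5t$ for all $t>0$, for some constant $c_5>0$. For $m\ge1$ let $\rho_{m,T}$ be the $\mathcal L^2$-convergence rate of the checkerboard (equivalently, the lexicographic) Gibbs sampler on the knot vector $\mathcal G$, let $\mathcal T(T,m)=-1/\log\rho_{m,T}$, and define $$C_{\mathrm{blocking}}(T,m):=\mathcal T(T,m)\cdot m\cdot C_{\mathrm{rej}}\!\left(\tfrac{2T}{m+1}\right).$$ Then for every $c_1>0$ and $\chi_1>0$, with $m(T)=\lceil c_1T^{1+\chi_1}\rceil$, $$C_{\mathrm{blocking}}(T,m(T))=\mathcal O\!\left(T^{3+2\chi_1}\right)\quad\text{as }T\to\infty$$ (in particular $\mathcal O(T^{3+\chi_2})$ for arbitrarily small $\chi_2>0$). In case (a) the same holds with $\chi_1=0$, i.e. with $m(T)=\lceil c_1T\rceil$ one has $C_{\mathrm{blocking}}(T,m(T))=\mathcal O(T^3)$.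
   Context: Knots: fix $m\ge1$, $\delta=\delta_{m,T}:=T/(m+1)$, anchors $k_i=i\delta$, $i=1,\dots,m$. The knot vector $\mathcal G=(X_{k_1},\dots,X_{k_m})$ conditioned on $(X_0,X_T)=(x_0,x_T)$ is a nondegenerate Gaussian vector in $\mathbb R^m$ with law $\pi$. Checkerboard Gibbs sweep: first update all odd-indexed coordinates of $\mathcal G$ jointly from their conditional law given the even-indexed ones, then all even-indexed coordinates from their conditional law given the odd-indexed ones. Lexicographic Gibbs sweep: update coordinate $1$ from its full conditional law given the others, then coordinate $2$, ..., then coordinate $m$. A sweep defines a Markov kernel $P$ with invariant law $\pi$. $\mathcal L^2$-convergence rate: the smallest $\rho$ such that for every $f\in L^2(\pi)$ and every $r>\rho$ there is $V_f>0$ with $\int\left[P^nf(x)-\pi(f)\right]^2\pi(\mathrm dx)\le V_f r^n$ for all $n$, where $P^nf(x)=\mathbb E[f(\mathcal G^{(n)})\mid\mathcal G^{(0)}=x]$. *)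

(* Defs.v *)
From HB Require Import structures.
From mathcomp Require Import all_boot all_order all_algebra.
From mathcomp Require Import all_classical all_reals all_analysis.
From mathcomp Require Import normal_distribution.
Set Implicit Arguments. Unset Strict Implicit. Unset Printing Implicit Defensive.
Import Order.TTheory GRing.Theory Num.Theory.
Import numFieldNormedType.Exports.
Local Open Scope classical_set_scope.
Local Open Scope ring_scope.

Section Blocking.
Variable R : realType.

(* A transition density: tdens t a y = density at y of X_{s+t} given X_s = a. *)

(* (a) scaled Brownian motion sigma W:  X_{s+t} | X_s = a  ~  N(a, sigma^2 t). *)
Definition bm_tdens (sigma : R) : R -> R -> R -> R :=
  fun t a y => normal_pdf a (sigma * Num.sqrt t) y.

(* (b) OU  dX = -theta X dt + sigma dW :
   X_{s+t} | X_s = a ~ N(a e^{-theta t}, sigma^2 (1 - e^{-2 theta t}) / (2 theta)). *)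
Definition ou_tdens (theta sigma : R) : R -> R -> R -> R :=
  fun t a y => normal_pdf (a * expR (- (theta * t)))
      (Num.sqrt (sigma ^+ 2 * (1 - expR (- (2 * theta * t))) / (2 * theta))) y.

(* states of the knot vector are points of R^m, represented as m.-tuple R
   (with MathComp-Analysis' product sigma-algebra on tuples). *)

Definition delta (T : R) (m : nat) : R := T / m.+1%:R.

Definition knot_val (m : nat) (x0 xT : R) (x : m.-tuple R) (k : nat) : R :=
  if k == 0%N then x0 else if k == m.+1 then xT else nth 0 x k.-1.

(* unnormalised Lebesgue density on R^m of the law pi of G given (X_0,X_T)=(x0,xT):
   by the Markov property, prod_{k=0}^{m} p_delta(x_k, x_{k+1}). *)
Definition knot_dens (tdens : R -> R -> R -> R) (x0 xT T : R) (m : nat)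
  (x : m.-tuple R) : R :=
  \prod_(k < m.+1) tdens (delta T m) (knot_val x0 xT x k) (knot_val x0 xT x k.+1).

Definition set_coord (m : nat) (x : m.-tuple R) (i : 'I_m) (y : R) : m.-tuple R :=
  [tuple if j == i then y else tnth x j | j < m].

Fixpoint blk_int (m : nat) (S : seq 'I_m) (g : m.-tuple R -> \bar R)
  (x : m.-tuple R) : \bar R :=
  match S with
  | [::] => g x
  | i :: S' => (\int[lebesgue_measure]_y blk_int S' g (set_coord x i y))%E
  end.

Definition zero_tuple (m : nat) : m.-tuple R := [tuple (0 : R) | _ < m].

Definition int_Rm (m : nat) (g : m.-tuple R -> \bar R) : \bar R :=
  blk_int (enum 'I_m) g (zero_tuple m).

Definition knot_Z tdens x0 xT T (m : nat) : R :=
  fine (int_Rm (fun x : m.-tuple R => (knot_dens tdens x0 xT T x)%:E)).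

Definition pi_int tdens x0 xT T (m : nat) (g : m.-tuple R -> R) : \bar R :=
  int_Rm (fun x => (g x * knot_dens tdens x0 xT T x / knot_Z tdens x0 xT T m)%:E).

Definition L2pi tdens x0 xT T (m : nat) (f : m.-tuple R -> R) : Prop :=
  measurable_fun setT f /\ (pi_int tdens x0 xT T (fun x => (f x ^+ 2)%R) < +oo)%E.

(* Block Gibbs update of the coordinates in S from their conditional law under
   pi given the other coordinates (conditional density = pi's density in the
   coordinates of S, normalised):  (U_S g)(x) = E[g(x with S resampled)]. *)
Definition block_update tdens x0 xT T (m : nat) (S : seq 'I_m) (g : m.-tuple R -> R)
  (x : m.-tuple R) : R :=
  fine (blk_int S (fun z => (g z * knot_dens tdens x0 xT T z)%:E) x) /
  fine (blk_int S (fun z => (knot_dens tdens x0 xT T z)%:E) x).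

(* odd-indexed coordinates 1,3,5,... (1-based) are the 0-based even ordinals *)
Definition odd_block (m : nat) : seq 'I_m := [seq i : 'I_m <- enum 'I_m | ~~ odd i].
Definition even_block (m : nat) : seq 'I_m := [seq i : 'I_m <- enum 'I_m | odd i].

(* checkerboard sweep: first the odd block, then the even block;
   P g (x) = E[g(G^(1)) | G^(0) = x] = U_odd (U_even g) (x). *)
Definition checker_P tdens x0 xT T (m : nat) (g : m.-tuple R -> R) : m.-tuple R -> R :=
  block_update tdens x0 xT T (odd_block m) (block_update tdens x0 xT T (even_block m) g).

Definition L2_rate_set tdens x0 xT T (m : nat) : set R :=
  [set rho | forall f : m.-tuple R -> R, L2pi tdens x0 xT T f ->
     forall r : R, rho < r -> exists V : R, 0 < V /\ forall n : nat,
       (pi_int tdens x0 xT T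
          (fun x => (iter n (@checker_P tdens x0 xT T m) f x
                     - fine (pi_int tdens x0 xT T f)) ^+ 2)%R
        <= ((V * r ^+ n)%R)%:E)%E].

Definition rho_mT tdens x0 xT T (m : nat) : R := inf (L2_rate_set tdens x0 xT T m).

Definition relax_time tdens x0 xT T (m : nat) : R := - (ln (rho_mT tdens x0 xT T m))^-1.

Definition C_blocking tdens x0 xT (Crej : R -> R) (T : R) (m : nat) : R :=
  relax_time tdens x0 xT T m * m%:R * Crej (2 * T / m.+1%:R).

Definition m_of_T (c1 chi1 T : R) : nat := `| Num.ceil (c1 * T `^ (1 + chi1)) |%N.

Definition bigO_pow (F : R -> R) (e : R) : Prop :=
  exists M : R, exists T1 : R, forall T : R, T1 <= T -> `|F T| <= M * T `^ e.

End Blocking.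

(* Main.v *)
(* In the knot vector, the odd and the even block are each conditionally independent given
   the other, and each coordinate given its neighbours is normal with mean
   [alpha / (1 + alpha^2)] times the sum of the neighbours, where [alpha = 1] for Brownian
   motion and [alpha = exp (- theta delta)] for the OU process.  Hence the sweep moves the
   mean by a nonnegative matrix bounded by the averaging of neighbours, which contracts a
   weighted sup norm with rate [c = 1 - 4 / (m + 1)^2] per half sweep.

   A bounded function becomes Lipschitz after one sweep, since translates of a normal
   density are close in total variation; from then on its Lipschitz constant, hence its
   standard deviation under [pi], decays like [c^j] in the number [j] of half sweeps.  The
   half sweeps are orthogonal projections of [L^2(pi)], so the squared norms [b_j] of the
   iterates are log-convex in [j]; log-convexity turns the decay [b_j <= C_f c^(2 j)] into
   the uniform contraction [b_(j+1) <= c^2 b_j], which extends to all of [L^2(pi)] by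
   truncation and Fatou's lemma.  Therefore [rho <= c^4], the relaxation time is at most
   [(m + 1)^2 / 4], and the cost is [O(T m^2)]. *)
Require Import Defs.
From HB Require Import structures.
From mathcomp Require Import all_boot all_order all_algebra.
From mathcomp Require Import all_classical all_reals all_analysis.
From mathcomp Require Import measurable_realfun normal_distribution.
From mathcomp Require Import finmap ring lra.
Set Implicit Arguments. Unset Strict Implicit. Unset Printing Implicit Defensive.
Import Order.TTheory GRing.Theory Num.Theory.
Import numFieldNormedType.Exports.
Local Open Scope classical_set_scope.
Local Open Scope ring_scope.

(** Log-convexity of the norms stands in for the spectral theorem of a product of two projections:
    it turns decay with an uncontrolled constant for each bounded [f] into one rate in which that
    constant is gone. The Lipschitz estimate may therefore be crude: the sup bound of [f], the
    number of sites and the total variation constant all disappear, and only [c] survives.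

    The exact Dirichlet eigenvector sin(pi k / (m + 1)) would give the factor cos(pi / (m + 1)),
    about 1 - 4.93 / (m + 1)^2; the parabola k (m + 1 - k) loses only in the constant, which the
    O-bound absorbs. As alpha / (1 + alpha^2) is at most 1/2, the OU chain is estimated as if it
    were Brownian.

    The obstacle is that [pi] and the updates are given as iterated Lebesgue integrals under [fine],
    not as measures. On nonnegative functions, Tonelli and monotone convergence identify them with
    integration against measures; signed functions are then split into positive and negative parts,
    and for unbounded [f] the updates are controlled only almost everywhere. *)

Section RealSequences.
Variable R : realType.

Lemma geometric_unbounded (r B : R) : 1 < r -> exists k, B < r ^+ k.
Proof.
move=> r1; have e0 : 0 < r - 1 by rewrite subr_gt0.
have bern k : 1 + k%:R * (r - 1) <= r ^+ k.
  elim: k => [|k IH]; first by rewrite mul0r addr0 expr0.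
  rewrite exprS (@le_trans _ _ (r * (1 + k%:R * (r - 1))))//; last first.
    by rewrite ler_pM2l// (lt_trans ltr01).
  rewrite -subr_ge0 -natr1.
  have -> : r * (1 + k%:R * (r - 1)) - (1 + (k%:R + 1) * (r - 1)) = k%:R * (r - 1) ^+ 2
    by ring.
  by rewrite mulr_ge0// sqr_ge0.
have := archi_boundP (normr_ge0 (B / (r - 1))); set k := Num.bound _ => hk.
exists k; apply: lt_le_trans (bern k).
have : B / (r - 1) < k%:R by apply: le_lt_trans hk; exact: ler_norm.
by rewrite ltr_pdivrMr// => h; apply: lt_le_trans h _; rewrite lerDr.
Qed.

(** If one ratio [b j.+1 / b j] exceeded [q], log-convexity would keep all later ratios at least as
    large, and the sequence would overtake [C * q ^+ j] whatever [C] is. *)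
Lemma logconvex_ratio_le (b : nat -> R) (C q : R) :
  (forall j, 0 <= b j) -> (forall j, b j.+1 ^+ 2 <= b j * b j.+2) ->
  0 < q -> (forall j, b j <= C * q ^+ j) -> forall j, b j.+1 <= q * b j.
Proof.
move=> b0 lc q0 bC j; rewrite leNgt; apply/negP => h.
have bS0 : 0 < b j.+1 by apply: le_lt_trans h; rewrite mulr_ge0// ltW.
have bj0 : 0 < b j.
  rewrite lt0r b0 andbT; apply/eqP => bE; have := lc j.
  by rewrite bE mul0r leNgt exprn_gt0.
pose rho := b j.+1 / b j.
have rho0 : 0 < rho by rewrite divr_gt0.
have qrho : 1 < rho / q by rewrite ltr_pdivlMr// mul1r /rho ltr_pdivlMr.
have step k : 0 < b (k + j)%N /\ rho * b (k + j)%N <= b (k + j).+1.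
  elim: k => [|k [IH1 IH2]]; first by rewrite add0n /rho divfK ?gt_eqF.
  have bp : 0 < b (k + j).+1 by apply: lt_le_trans IH2; rewrite mulr_gt0.
  split => //; rewrite addSn.
  have h1 : rho * b (k + j)%N * b (k + j).+2 <= b (k + j).+1 * b (k + j).+2.
    by rewrite ler_wpM2r.
  have h2 : rho * b (k + j).+1 ^+ 2 <= rho * (b (k + j)%N * b (k + j).+2).
    by rewrite ler_pM2l.
  rewrite -(ler_pM2l bp); apply: le_trans h1.
  by rewrite mulrCA -expr2 -[leRHS]mulrA.
have low k : rho ^+ k * b j <= b (k + j)%N.
  elim: k => [|k IH]; first by rewrite expr0 mul1r add0n.
  rewrite addSn exprS -mulrA; apply: le_trans (step k).2.
  by rewrite ler_pM2l.
have [k hk] := geometric_unbounded (C * q ^+ j / b j) qrho.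
move: hk; apply/negP; rewrite -leNgt expr_div_n ler_pdivrMr ?exprn_gt0//.
rewrite mulrAC ler_pdivlMr// -mulrA -exprD addnC.
exact: le_trans (low k) (bC _).
Qed.

End RealSequences.

(** * Iterated integrals over a list of coordinates *)

Section IteratedIntegral.
Variables (R : realType) (m : nat).
Implicit Types (S : seq 'I_m) (x : m.-tuple R) (i j : 'I_m).
Local Notation mu := (@lebesgue_measure R).

Lemma tnth_set_coord x i y j :
  tnth (set_coord x i y) j = if j == i then y else tnth x j.
Proof. by rewrite tnth_mktuple. Qed.

Lemma set_coordC x i j (y z : R) : i != j ->
  set_coord (set_coord x i y) j z = set_coord (set_coord x j z) i y.
Proof.
move=> ij; apply: eq_from_tnth => k; rewrite !tnth_set_coord.
by case: eqVneq => [->|//]; rewrite eq_sym (negbTE ij).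
Qed.

Lemma measurable_set_coord i : measurable_fun setT
  (fun p : m.-tuple R * measurableTypeR R => set_coord p.1 i p.2).
Proof.
apply/measurable_fun_tnthP => j.
rewrite (_ : _ \o _ = fun p : m.-tuple R * measurableTypeR R =>
   if j == i then p.2 else tnth p.1 j); last first.
  by apply/funext => p /=; rewrite tnth_set_coord.
case: (j == i); first exact: measurable_snd.
exact: (measurableT_comp (measurable_tnth j) measurable_fst).
Qed.

Lemma measurable_set_coordr x i :
  measurable_fun setT (fun y : measurableTypeR R => set_coord x i y).
Proof.
apply: (@measurableT_comp _ _ _ _ _ _
  (fun p : m.-tuple R * measurableTypeR R => set_coord p.1 i p.2) _
  (fun y : measurableTypeR R => (x, y))); first exact: measurable_set_coord.
exact: measurable_pair1.
Qed.

Local Open Scope ereal_scope.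

Lemma ge0_measurable_integral_coord i (g : m.-tuple R -> \bar R) :
  measurable_fun setT g -> (forall x, 0 <= g x) ->
  measurable_fun setT (fun x => \int[mu]_y g (set_coord x i y)).
Proof.
move=> mg g0.
apply: (@measurable_fun_fubini_tonelli_F _ _ _ _ _ mu
  (fun p : m.-tuple R * measurableTypeR R => g (set_coord p.1 i p.2))) => //.
exact: (measurableT_comp mg (measurable_set_coord i)).
Qed.

Lemma measurable_integral_coord i (g : m.-tuple R -> \bar R) :
  measurable_fun setT g ->
  measurable_fun setT (fun x => \int[mu]_y g (set_coord x i y)).
Proof.
move=> mg.
rewrite (_ : (fun x => _) = (fun x => \int[mu]_y (g^\+ (set_coord x i y))
    - \int[mu]_y (g^\- (set_coord x i y)))); last first.
  apply: funext => x; rewrite integralE.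
  by congr (_ - _); apply: eq_integral => y _; rewrite ?funeposE ?funenegE.
apply: emeasurable_funB; apply: ge0_measurable_integral_coord => //.
- exact: measurable_funepos.
- exact: measurable_funeneg.
Qed.

Lemma measurable_blk_int S (g : m.-tuple R -> \bar R) :
  measurable_fun setT g -> measurable_fun setT (blk_int S g).
Proof. by move=> mg; elim: S => //= i S IH; exact: measurable_integral_coord. Qed.

Lemma measurable_blk_slice x i S (g : m.-tuple R -> \bar R) :
  measurable_fun setT g -> measurable_fun setT
    (fun y : measurableTypeR R => blk_int S g (set_coord x i y)).
Proof.
move=> /(measurable_blk_int S) mg.
exact: (measurableT_comp mg (measurable_set_coordr x i)).
Qed.

Lemma blk_int_ge0 S (g : m.-tuple R -> \bar R) x :
  (forall z, 0 <= g z) -> 0 <= blk_int S g x.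
Proof. by move=> g0; elim: S x => //= i S IH x; exact: integral_ge0. Qed.

Lemma eq_blk_int S (f g : m.-tuple R -> \bar R) : f =1 g ->
  blk_int S f =1 blk_int S g.
Proof. by move=> /funext ->. Qed.

Lemma le_blk_int S (f g : m.-tuple R -> \bar R) x :
  measurable_fun setT f -> measurable_fun setT g ->
  (forall z, 0 <= f z) -> (forall z, f z <= g z) ->
  blk_int S f x <= blk_int S g x.
Proof.
move=> mf mg f0 fg; elim: S x => //= i S IH x.
apply: ge0_le_integral => //.
- by move=> y _; exact: blk_int_ge0.
- exact: measurable_blk_slice.
- exact: measurable_blk_slice.
Qed.

Lemma blk_intD S (f g : m.-tuple R -> \bar R) x :
  measurable_fun setT f -> measurable_fun setT g ->
  (forall z, 0 <= f z) -> (forall z, 0 <= g z) ->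
  blk_int S (fun z => f z + g z) x = blk_int S f x + blk_int S g x.
Proof.
move=> mf mg f0 g0; elim: S x => //= i S IH x.
under eq_integral do rewrite IH.
rewrite ge0_integralD//.
- by move=> y _; exact: blk_int_ge0.
- exact: measurable_blk_slice.
- by move=> y _; exact: blk_int_ge0.
- exact: measurable_blk_slice.
Qed.

Lemma blk_int_cvg S (g : nat -> m.-tuple R -> \bar R) x :
  (forall n, measurable_fun setT (g n)) -> (forall n z, 0 <= g n z) ->
  (forall z, nondecreasing_seq (g^~ z)) ->
  blk_int S (fun z => limn (g^~ z)) x = limn (fun n => blk_int S (g n) x).
Proof.
move=> mg g0 ndg; elim: S x => //= i S IH x.
under eq_integral do rewrite IH.
rewrite monotone_convergence//.
- by move=> n; exact: measurable_blk_slice.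
- by move=> n y _; exact: blk_int_ge0.
- by move=> y _ a b ab; apply: le_blk_int => // z; exact: ndg.
Qed.

Definition indep_of S T (h : m.-tuple R -> T) :=
  forall i, i \in S -> forall x y, h (set_coord x i y) = h x.

Lemma indep_of_cons i S T (h : m.-tuple R -> T) :
  indep_of (i :: S) h -> indep_of S h.
Proof. by move=> hi j jS; apply: hi; rewrite inE jS orbT. Qed.

Lemma indep_of_comp S T U (h : m.-tuple R -> T) (f : T -> U) :
  indep_of S h -> indep_of S (fun x => f (h x)).
Proof. by move=> hi i iS x y; rewrite hi. Qed.

Lemma blk_intM S (h g : m.-tuple R -> \bar R) x :
  indep_of S h -> measurable_fun setT g ->
  (forall z, 0 <= h z) -> (forall z, 0 <= g z) ->
  blk_int S (fun z => h z * g z) x = h x * blk_int S g x.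
Proof.
move=> + mg h0 g0; elim: S x => //= i S IH x hS.
under eq_integral => y _.
  rewrite (IH _ (indep_of_cons hS)) hS; last by rewrite inE eqxx.
  over.
rewrite ge0_integralZl//.
- exact: measurable_blk_slice.
- by move=> y _; exact: blk_int_ge0.
Qed.

Lemma blk_int_indep S (g : m.-tuple R -> \bar R) : indep_of S (blk_int S g).
Proof.
elim: S => //= i S IH j jS x y.
apply: eq_integral => z _.
have [<-|ji] := eqVneq j i.
  congr (blk_int _ _ _); apply: eq_from_tnth => k; rewrite !tnth_set_coord.
  by case: (k == j).
rewrite set_coordC// IH//.
by move: jS; rewrite inE (negbTE ji).
Qed.

Lemma blk_int_cat S1 S2 (g : m.-tuple R -> \bar R) :
  blk_int (S1 ++ S2) g =1 blk_int S1 (blk_int S2 g).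
Proof. by elim: S1 => //= i S1 IH x; apply: eq_integral => y _; exact: IH. Qed.

Lemma blk_intC i j S (g : m.-tuple R -> \bar R) :
  measurable_fun setT g -> (forall z, 0 <= g z) ->
  blk_int (i :: j :: S) g =1 blk_int (j :: i :: S) g.
Proof.
move=> mg g0 x; have [->//|ij] := eqVneq i j.
pose F (p : measurableTypeR R * measurableTypeR R) :=
  blk_int S g (set_coord (set_coord x i p.1) j p.2).
transitivity (\int[mu]_y \int[mu]_z F (y, z)); first by [].
rewrite (@fubini_tonelli _ _ _ _ _ mu mu F).
- apply: eq_integral => z _ /=; apply: eq_integral => y _.
  by rewrite /F /= set_coordC.
- apply: (measurableT_comp (measurable_blk_int S mg)).
  apply: (@measurableT_comp _ _ _ _ _ _
    (fun p : m.-tuple R * measurableTypeR R => set_coord p.1 j p.2) _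
    (fun p : measurableTypeR R * measurableTypeR R => (set_coord x i p.1, p.2))).
    exact: measurable_set_coord.
  apply/measurable_fun_pairP; split; last exact: measurable_snd.
  exact: (measurableT_comp (measurable_set_coordr x i) measurable_fst).
- by move=> p; exact: blk_int_ge0.
Qed.

Lemma blk_int_perm S1 S2 (g : m.-tuple R -> \bar R) :
  measurable_fun setT g -> (forall z, 0 <= g z) ->
  perm_eq S1 S2 -> blk_int S1 g =1 blk_int S2 g.
Proof.
move=> mg g0.
have front i T1 T2 : blk_int (T1 ++ i :: T2) g =1 blk_int (i :: T1 ++ T2) g.
  elim: T1 => //= j T1 IH x.
  rewrite -[RHS]/(blk_int (i :: j :: T1 ++ T2) g x) blk_intC//.
  by apply: eq_integral => y _; exact: IH.
elim: S1 S2 => [|i S1 IH] S2 pS x.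
  by rewrite perm_sym in pS; rewrite (perm_nilP pS).
have iS2 : i \in S2 by rewrite -(perm_mem pS) inE eqxx.
case/splitPr: iS2 pS => T1 T2 pS.
rewrite front /=; apply: eq_integral => y _; apply: IH.
by rewrite -(perm_cons i) (perm_trans pS)// perm_catC /= perm_cons perm_catC.
Qed.

(** If an integral vanished, its positive integrand would be zero almost everywhere, so the whole
    line would be a null set. *)
Lemma blk_int_gt0 S (g : m.-tuple R -> \bar R) x :
  measurable_fun setT g -> (forall z, 0 < g z) -> 0 < blk_int S g x.
Proof.
move=> mg g0; elim: S x => //= i S IH x.
rewrite lt0e integral_ge0 ?andbT; last by move=> y _; exact: ltW.
apply/eqP => /eqP.
have mh : measurable_fun setT (fun y : measurableTypeR R => blk_int S g (set_coord x i y)).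
  exact: measurable_blk_slice.
rewrite (_ : integral _ _ _ =
    \int[mu]_y `|blk_int S g (set_coord x i y)|); last first.
  by apply: eq_integral => y _; rewrite gee0_abs// ltW.
move=> /eqP /(ae_eq_integral_abs _ _ mh) [] // N [mN N0 sN].
have NT : N = setT.
  by apply/seteqP; split => // y _; apply: sN => /= /(_ I) h;
    have := IH (set_coord x i y); rewrite h ltxx.
have : mu `]-oo, +oo[%classic = +oo by rewrite lebesgue_measure_itv.
by rewrite set_itvNyy -NT => /(eq_trans (esym N0)).
Qed.

(** Inner integrals of a signed function may be of the form [+oo - oo]; finiteness for [|h|]
    confines this to null sets at every level. *)
Lemma blk_int_signed S (h : m.-tuple R -> \bar R) x :
  measurable_fun setT h -> blk_int S (fun z => `|h z|) x < +oo ->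
  blk_int S h x = blk_int S h^\+ x - blk_int S h^\- x.
Proof.
move=> mh; elim: S x => /= [|i S IH] x hoo; first by rewrite {1}(funeposneg h).
have mp : measurable_fun setT h^\+ by exact: measurable_funepos.
have mn : measurable_fun setT h^\- by exact: measurable_funeneg.
have ma : measurable_fun setT (fun z => `|h z|) by exact: measurableT_comp.
have ip : mu.-integrable setT (fun y => blk_int S h^\+ (set_coord x i y)).
  apply/integrableP; split; first exact: measurable_blk_slice.
  apply: le_lt_trans hoo; apply: ge0_le_integral => //.
  - by apply: measurableT_comp => //; exact: measurable_blk_slice.
  - exact: measurable_blk_slice.
  - move=> y _; rewrite gee0_abs ?blk_int_ge0//.
    by apply: le_blk_int => // z; rewrite -/((abse \o h) z) fune_abse leeDl.
have in' : mu.-integrable setT (fun y => blk_int S h^\- (set_coord x i y)).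
  apply/integrableP; split; first exact: measurable_blk_slice.
  apply: le_lt_trans hoo; apply: ge0_le_integral => //.
  - by apply: measurableT_comp => //; exact: measurable_blk_slice.
  - exact: measurable_blk_slice.
  - move=> y _; rewrite gee0_abs ?blk_int_ge0//.
    by apply: le_blk_int => // z; rewrite -/((abse \o h) z) fune_abse leeDr.
(* The induction hypothesis is available only for those [y] whose inner integral of [|h|] is finite,
   hence equality almost everywhere. *)
rewrite -integralB//; apply: ae_eq_integral => //.
- exact: measurable_blk_slice.
- by apply: emeasurable_funB; exact: measurable_blk_slice.
- have : mu.-integrable setT (fun y => blk_int S (fun z => `|h z|) (set_coord x i y)).
    apply/integrableP; split; first exact: measurable_blk_slice.
    apply: le_lt_trans hoo; apply: ge0_le_integral => //.
    - by apply: measurableT_comp => //; exact: measurable_blk_slice.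
    - exact: measurable_blk_slice.
    - by move=> y _; rewrite gee0_abs ?blk_int_ge0//.
  move=> /(integrable_ae measurableT); apply: filterS => y yfin _.
  by apply: IH; move: (yfin I); rewrite ge0_fin_numE ?blk_int_ge0.
Qed.

End IteratedIntegral.

(** * From positive, monotonically continuous functionals to measures *)

Section FunctionalMeasure.
Local Open Scope ereal_scope.
Context d (T : measurableType d) (R : realType).
Variable Phi : (T -> \bar R) -> \bar R.
Hypothesis Phi_ge0 : forall g, (forall x, 0 <= g x) -> 0 <= Phi g.
Hypothesis PhiD : forall f g, measurable_fun setT f -> measurable_fun setT g ->
  (forall x, 0 <= f x) -> (forall x, 0 <= g x) ->
  Phi (fun x => f x + g x) = Phi f + Phi g.
Hypothesis PhiZ : forall (c : R) g, (0 <= c)%R -> measurable_fun setT g ->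
  (forall x, 0 <= g x) -> Phi (fun x => c%:E * g x) = c%:E * Phi g.
Hypothesis Phi_cvg : forall g : nat -> T -> \bar R,
  (forall n, measurable_fun setT (g n)) -> (forall n x, 0 <= g n x) ->
  (forall x, nondecreasing_seq (g^~ x)) ->
  Phi (fun x => limn (g^~ x)) = limn (fun n => Phi (g n)).

Let Phi0 : Phi (fun=> 0) = 0.
Proof.
rewrite -[RHS](mul0e (Phi (fun=> 0))) -[RHS](@PhiZ 0%R (fun=> 0))//.
by congr Phi; apply/funext => x; rewrite mul0e.
Qed.

Let Phi_sum I (r : seq I) (F : I -> T -> \bar R) :
  (forall i, measurable_fun setT (F i)) -> (forall i x, 0 <= F i x) ->
  Phi (fun x => \sum_(i <- r) F i x) = \sum_(i <- r) Phi (F i).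
Proof.
move=> mF F0; elim: r => [|i r IH].
  by rewrite big_nil -[RHS]Phi0; congr Phi; apply/funext => x; rewrite big_nil.
rewrite big_cons -IH -PhiD//.
- by congr Phi; apply/funext => x; rewrite big_cons.
- exact: emeasurable_sum.
- by move=> x; apply: sume_ge0.
Qed.

Let k (A : set T) : \bar R := Phi (fun x => (\1_A x)%:E).

Let k0 : k set0 = 0.
Proof. by rewrite /k -[RHS]Phi0; congr Phi; apply/funext => x; rewrite indic0. Qed.

Let k_ge0 A : 0 <= k A.
Proof. by apply: Phi_ge0 => x; rewrite lee_fin. Qed.

Let k_sigma_additive : semi_sigma_additive k.
Proof.
move=> F mF tF mUF.
pose G n x := \sum_(0 <= i < n) (\1_(F i) x : R)%:E.
have mG n : measurable_fun setT (G n).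
  apply: emeasurable_sum => i.
  exact/measurable_EFinP/measurable_indic.
have G0 n x : 0 <= G n x by apply: sume_ge0 => i _; rewrite lee_fin.
have ndG x : nondecreasing_seq (G^~ x).
  by apply: (@ereal_nondecreasing_series R (fun i => (\1_(F i) x : R)%:E) xpredT 0) => i
    _ _; rewrite lee_fin.
have -> : k (\bigcup_n F n) = limn (fun n => Phi (G n)).
  rewrite -Phi_cvg//; congr Phi; apply/funext => x.
  by rewrite indic_bigcup//.
rewrite (_ : (fun n => \sum_(0 <= i < n) k (F i)) = (fun n => Phi (G n))).
  apply: ereal_nondecreasing_is_cvgn => a b ab.
  rewrite (_ : G b = fun x => G a x + \sum_(a <= i < b) (\1_(F i) x : R)%:E); last first.
    by apply/funext => x; rewrite /G (@big_cat_nat _ _ _ a).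
  rewrite PhiD//.
  - by rewrite leeDl// Phi_ge0// => x; apply: sume_ge0 => i _; rewrite lee_fin.
  - apply: emeasurable_sum => i; exact/measurable_EFinP/measurable_indic.
  - by move=> x; apply: sume_ge0 => i _; rewrite lee_fin.
apply/funext => n; rewrite /G Phi_sum// => i.
exact/measurable_EFinP/measurable_indic.
Qed.

HB.instance Definition _ := isMeasure.Build _ _ _ k k0 k_ge0 k_sigma_additive.

Import HBNNSimple.

(** A Daniell-type representation: both sides agree on simple functions by additivity and
    homogeneity, and pass to increasing limits. *)
Lemma ge0_functional_measure : exists kappa : {measure set T -> \bar R},
  forall g : T -> \bar R, measurable_fun setT g -> (forall x, 0 <= g x) ->
  \int[kappa]_x g x = Phi g.
Proof.
exists k => g mg g0.
pose g_ := nnsfun_approx measurableT mg.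
have gE : g = fun x => limn (fun n => (g_ n x)%:E).
  by apply/funext => x; apply/esym/cvg_lim => //; exact: cvg_nnsfun_approx.
have mg_ n : measurable_fun setT (fun x => (g_ n x)%:E) by exact/measurable_EFinP.
have g_0 n x : 0 <= (g_ n x)%:E by rewrite lee_fin.
have ndg_ x : nondecreasing_seq (fun n => (g_ n x)%:E).
  by move=> a b ab; rewrite lee_fin; exact/lefP/nd_nnsfun_approx.
rewrite gE Phi_cvg// monotone_convergence//.
congr (limn _); apply/funext => n.
have fr : finite_set (range (g_ n)) by exact: fimfunP.
have sE : (fun x => (g_ n x)%:E) = fun x => \sum_(r <- fset_set (range (g_ n)))
    (r%:E * (\1_(g_ n @^-1` [set r]) x)%:E).
  by apply/funext => x; rewrite fimfunE -fsumEFin// fsbig_finite.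
have mS r : measurable_fun setT (fun x => r%:E * (\1_(g_ n @^-1` [set r]) x)%:E).
  by apply/measurable_EFinP/measurable_funM => //.
have S0 r x : 0 <= r%:E * (\1_(g_ n @^-1` [set r]) x)%:E.
  by rewrite nnfun_muleindic_ge0.
rewrite sE ge0_integral_sum// Phi_sum//.
rewrite [LHS]big_seq [RHS]big_seq; apply: eq_bigr => r.
rewrite in_fset_set// => /set_mem [y _ <-].
rewrite ge0_integralZl_EFin//; last exact/measurable_EFinP/measurable_indic.
  by rewrite integral_indic// setIT PhiZ//; exact/measurable_EFinP/measurable_indic.
Qed.

End FunctionalMeasure.

Section BlockMeasure.
Variables (R : realType) (m : nat).
Local Open Scope ereal_scope.

(** Makes dominated convergence, Fatou and linearity available; the stationary law and the
    conditional laws are both obtained from it. Integrability under [kappa] is the absolute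
    finiteness that [blk_int_signed] asks for. *)
Lemma blk_int_measure (S : seq 'I_m) (w : m.-tuple R -> R) (x : m.-tuple R) :
  measurable_fun setT w -> (forall z, (0 <= w z)%R) ->
  exists kappa : {measure set (m.-tuple R) -> \bar R},
  (forall g, measurable_fun setT g -> (forall z, 0 <= g z) ->
    \int[kappa]_z g z = blk_int S (fun z => g z * (w z)%:E) x) /\
  (forall g, kappa.-integrable setT g ->
    \int[kappa]_z g z = blk_int S (fun z => g z * (w z)%:E) x).
Proof.
move=> mw w0.
have mW : measurable_fun setT (fun z => (w z)%:E) by exact/measurable_EFinP.
have mM g : measurable_fun setT g -> measurable_fun setT (fun z => g z * (w z)%:E).
  by move=> mg; exact: emeasurable_funM.
have M0 g : (forall z, 0 <= g z) -> forall z, 0 <= g z * (w z)%:E.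
  by move=> g0 z; rewrite mule_ge0// lee_fin.
have [||||kappa kE] := @ge0_functional_measure _ _ R
    (fun g => blk_int S (fun z => g z * (w z)%:E) x).
- by move=> g g0; apply: blk_int_ge0; exact: M0.
- move=> f g mf mg f0 g0; rewrite -blk_intD; [|exact: mM|exact: mM|exact: M0|exact: M0].
  by apply: eq_blk_int => z; rewrite ge0_muleDl.
- move=> c g c0 mg g0; rewrite -(@blk_intM _ _ _ (fun=> c%:E)).
  + by apply: eq_blk_int => z; rewrite muleA.
  + by [].
  + exact: mM.
  + by move=> z; rewrite lee_fin.
  + exact: M0.
- move=> g mg g0 ndg; rewrite -blk_int_cvg.
  + apply: eq_blk_int => z; rewrite -limeMr//.
      exact: ereal_nondecreasing_is_cvgn.
  + by move=> n; exact: mM.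
  + by move=> n; exact: M0.
  + by move=> z a b ab; apply: lee_wpmul2r; [rewrite lee_fin|exact: ndg].
exists kappa; split => // g /integrableP[mg goo].
have absE z : `|g z * (w z)%:E| = `|g z| * (w z)%:E.
  by rewrite abseM [X in _ * X]gee0_abs// lee_fin.
rewrite blk_int_signed; last 2 first.
- exact: mM.
- under eq_blk_int do rewrite absE.
  rewrite -(kE (fun z => `|g z|))//; exact: measurableT_comp.
rewrite integralE !kE//; [|exact: measurable_funeneg|exact: measurable_funepos].
congr (_ - _); apply: eq_blk_int => z.
- by rewrite !funeposE maxe_pMl ?lee_fin// mul0e.
- by rewrite !funenegE -mulNe maxe_pMl ?lee_fin// mul0e.
Qed.

End BlockMeasure.

(** * Expectations of bounded measurable functions *)

Section BoundedMeasurable.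
Context d (T : measurableType d) (R : realType).

(** An algebra of functions integrable under every probability measure, so that expectations are
    linear on it without further side conditions. *)
Definition bounded_measurable (g : T -> R) :=
  measurable_fun setT g /\ exists M : R, forall x, `|g x| <= M.

Lemma bounded_measurable_cst c : bounded_measurable (fun=> c).
Proof. by split; [exact: measurable_cst|exists `|c|]. Qed.

Lemma bounded_measurableD f g : bounded_measurable f -> bounded_measurable g ->
  bounded_measurable (fun x => f x + g x).
Proof.
move=> [mf [M hM]] [mg [N hN]]; split; first exact: measurable_funD.
by exists (M + N) => x; rewrite (le_trans (ler_normD _ _))// lerD.
Qed.

Lemma bounded_measurableM f g : bounded_measurable f -> bounded_measurable g ->
  bounded_measurable (fun x => f x * g x).
Proof.
move=> [mf [M hM]] [mg [N hN]]; split; first exact: measurable_funM.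
by exists (M * N) => x; rewrite normrM ler_pM.
Qed.

Lemma bounded_measurableZ c f : bounded_measurable f ->
  bounded_measurable (fun x => c * f x).
Proof. by move=> bf; apply: bounded_measurableM => //; exact: bounded_measurable_cst. Qed.

Lemma bounded_measurableB f g : bounded_measurable f -> bounded_measurable g ->
  bounded_measurable (fun x => f x - g x).
Proof.
move=> [mf [M hM]] [mg [N hN]]; split; first exact: measurable_funB.
by exists (M + N) => x; rewrite (le_trans (ler_normB _ _))// lerD.
Qed.

Variable P : {measure set T -> \bar R}.
Hypothesis P1 : P setT = 1%E.

Lemma bounded_measurable_integrable f : bounded_measurable f ->
  P.-integrable setT (EFin \o f).
Proof.
move=> [mf [M hM]]; apply: (@le_integrable _ _ _ _ _ _ _ (EFin \o cst M)) => //.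
- exact/measurable_EFinP.
- by move=> x _ /=; rewrite lee_fin (le_trans (hM x))// ler_norm.
- apply/integrableP; split; first exact/measurable_EFinP.
  rewrite (eq_integral (fun=> (`|M|)%:E)) ?integral_cst//=.
  by rewrite P1 mule1 ltry.
Qed.

Lemma bounded_expectation_cst c : \int[P]_x c = c.
Proof. by rewrite Rintegral_cst// P1 mulr1. Qed.

Lemma bounded_expectationD f g : bounded_measurable f -> bounded_measurable g ->
  \int[P]_x (f x + g x) = \int[P]_x f x + \int[P]_x g x.
Proof. by move=> bf bg; rewrite RintegralD//; exact: bounded_measurable_integrable. Qed.

Lemma bounded_expectationB f g : bounded_measurable f -> bounded_measurable g ->
  \int[P]_x (f x - g x) = \int[P]_x f x - \int[P]_x g x.
Proof. by move=> bf bg; rewrite RintegralB//; exact: bounded_measurable_integrable. Qed.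

Lemma bounded_expectationZ c f : bounded_measurable f ->
  \int[P]_x (c * f x) = c * \int[P]_x f x.
Proof. by move=> bf; rewrite RintegralZl//; exact: bounded_measurable_integrable. Qed.

Lemma le_bounded_expectation f g : bounded_measurable f -> bounded_measurable g ->
  (forall x, f x <= g x) -> \int[P]_x f x <= \int[P]_x g x.
Proof.
by move=> bf bg fg; apply: le_Rintegral => //; exact: bounded_measurable_integrable.
Qed.

Lemma bounded_expectationE f : bounded_measurable f ->
  (\int[P]_x f x)%:E = (\int[P]_x (f x)%:E)%E.
Proof.
move=> bf; rewrite fineK//.
exact/integrable_fin_num/bounded_measurable_integrable.
Qed.

Lemma norm_bounded_expectation (f : T -> R) M : measurable_fun setT f ->
  (forall x, `|f x| <= M) -> `|\int[P]_x f x| <= M.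
Proof.
move=> mf hM; have bf : bounded_measurable f by split => //; exists M.
rewrite ler_norml -[X in - X](bounded_expectation_cst M) -[X in _ && (_ <=
  X)](bounded_expectation_cst M).
rewrite -mulN1r -bounded_expectationZ; last exact: bounded_measurable_cst.
apply/andP; split; apply: le_bounded_expectation => //.
- exact: bounded_measurable_cst.
- by move=> x; rewrite mulN1r; have := hM x; rewrite ler_norml => /andP[].
- exact: bounded_measurable_cst.
- by move=> x; have := hM x; rewrite ler_norml => /andP[].
Qed.

End BoundedMeasurable.

(** * Block updates as conditional expectations *)

Section Gibbs.
Variables (R : realType) (m : nat) (p : m.-tuple R -> R).
Hypothesis mp : measurable_fun setT p.
Hypothesis p_gt0 : forall x, 0 < p x.
Local Notation X := (m.-tuple R).

Definition block_mass (S : seq 'I_m) (x : X) : R :=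
  fine (blk_int S (fun z => (p z)%:E) x).

(** With [p] the knot density this is convertible to [block_update], on which [checker_iter]
    relies. *)
Definition block_mean (S : seq 'I_m) (g : X -> R) (x : X) : R :=
  fine (blk_int S (fun z => (g z * p z)%:E) x) / block_mass S x.

Definition finite_mass (S : seq 'I_m) :=
  forall x, (blk_int S (fun z => (p z)%:E) x < +oo)%E.

Let mpE : measurable_fun setT (fun z => (p z)%:E).
Proof. exact/measurable_EFinP. Qed.

Lemma block_massE S x : finite_mass S ->
  (block_mass S x)%:E = blk_int S (fun z => (p z)%:E) x.
Proof.
move=> fS; rewrite fineK// ge0_fin_numE// blk_int_ge0// => z.
by rewrite lee_fin ltW.
Qed.

Lemma block_mass_gt0 S x : finite_mass S -> 0 < block_mass S x.
Proof.
move=> fS; rewrite -lte_fin block_massE//; exact: blk_int_gt0.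
Qed.

Lemma measurable_block_mass_inv S :
  measurable_fun setT (fun x => (block_mass S x)^-1).
Proof.
rewrite (_ : (fun _ => _) = fun x => block_mass S x `^ (-1)); last first.
  apply/funext => x; rewrite powR_inv1// fine_ge0// blk_int_ge0// => z.
  by rewrite lee_fin ltW.
apply: (@measurableT_comp _ _ _ _ _ _ (fun t : R => t `^ (-1)) _ (block_mass S)).
  exact: measurable_powR.
by apply: measurableT_comp => //; apply: measurable_blk_int.
Qed.

Lemma measurable_block_mean S g : measurable_fun setT g ->
  measurable_fun setT (block_mean S g).
Proof.
move=> mg; apply: measurable_funM.
- apply: measurableT_comp => //; apply: measurable_blk_int.
  by apply/measurable_EFinP/measurable_funM.
- exact: measurable_block_mass_inv.
Qed.

Lemma block_mean_indep S g : indep_of S (block_mean S g).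
Proof.
move=> i iS x y.
by rewrite /block_mean /block_mass !(@blk_int_indep _ _ S _ i iS).
Qed.

(** [Q] is the conditional law of the whole vector given the coordinates of [x] outside [S]. It is
    built for one [x] at a time; measurability in [x] comes from the iterated integrals instead. *)
Lemma block_kernel S x : finite_mass S ->
  exists Q : {measure set X -> \bar R}, [/\ Q setT = 1%E,
   (forall g, measurable_fun setT g -> (forall z, 0 <= g z)%E ->
     (\int[Q]_z g z = blk_int S (fun z => g z * (p z)%:E) x * ((block_mass S x)^-1)%:E)%E) &
   (forall g, Q.-integrable setT (EFin \o g) -> block_mean S g x = \int[Q]_z g z)].
Proof.
move=> fS; have Z0 := block_mass_gt0 x fS.
have Zi : 0 <= (block_mass S x)^-1 by rewrite invr_ge0 ltW.
have [||Q [Q1 Q2]] := @blk_int_measure R m S (fun z => (block_mass S x)^-1 * p z) x.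
- by apply: measurable_funM.
- by move=> z; rewrite mulr_ge0// ltW.
have Q1' g : measurable_fun setT g -> (forall z, 0 <= g z)%E ->
     (\int[Q]_z g z = blk_int S (fun z => g z * (p z)%:E) x * ((block_mass S x)^-1)%:E)%E.
  move=> mg g0; rewrite Q1// muleC -(@blk_intM _ _ _ (fun=> (block_mass S x)^-1%:E)%E)//.
  - by apply: eq_blk_int => z; rewrite EFinM muleCA.
  - exact: emeasurable_funM.
  - by move=> z; rewrite mule_ge0// lee_fin ltW.
exists Q; split => //.
  rewrite -[Q setT]mul1e -integral_cst// Q1'//.
  under eq_blk_int do rewrite mul1e.
  by rewrite -block_massE// -EFinM divff// gt_eqF.
move=> g ig; rewrite /Rintegral.
have /measurable_EFinP mg := measurable_int _ ig.
have iE : (blk_int S (fun z => (g z * p z)%:E) x = (block_mass S x)%:E * \int[Q]_z (g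
  z)%:E)%E.
  have sg h : (forall z, 0 <= h z)%E -> measurable_fun setT h -> (blk_int S (fun z => h z
    * (p z)%:E) x = (block_mass S x)%:E * \int[Q]_z h z)%E.
    by move=> h0 mh; rewrite Q1'// muleCA -EFinM divff ?gt_eqF// mule1.
  have [_ igoo] := integrableP _ _ _ ig.
  have mgp : measurable_fun setT (fun z => (g z * p z)%:E).
    by apply/measurable_EFinP; exact: measurable_funM.
  rewrite blk_int_signed//; last first.
    rewrite (@eq_blk_int _ _ _ _ (fun z => `|(g z)%:E| * (p z)%:E)%E); last first.
      by move=> z; rewrite EFinM abseM [X in (_ * X)%E]gee0_abs// lee_fin ltW.
    rewrite (sg (fun z => `|(g z)%:E|%E))//; last by apply: measurableT_comp => //;
      exact/measurable_EFinP.
    by rewrite lte_mul_pinfty// lee_fin ltW.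
  rewrite integralE muleBr//; last first.
    by rewrite fin_num_adde_defr// integrable_pos_fin_num.
  rewrite -!sg//; [|exact: measurable_funeneg (measurable_int _ ig)|exact:
    measurable_funepos (measurable_int _ ig)].
  congr (_ - _)%E; apply: eq_blk_int => z.
  - by rewrite !funeposE maxe_pMl ?lee_fin ?ltW// mul0e EFinM.
  - by rewrite !funenegE maxe_pMl ?lee_fin ?ltW// mul0e mulNe EFinM.
rewrite /block_mean iE fineM//; last exact: integrable_fin_num.
by rewrite /= mulrAC divff ?mul1r// gt_eqF// block_mass_gt0.
Qed.

(** Keeps infinite means, which [fine] in [block_mean] would send to [0]; this allows updates of
    unbounded functions to be dominated. *)
Definition block_emean (S : seq 'I_m) (g : X -> \bar R) (x : X) : \bar R :=
  (blk_int S (fun z => g z * (p z)%:E) x * ((block_mass S x)^-1)%:E)%E.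

Lemma block_emean_ge0 S g x : (forall z, 0 <= g z)%E -> (0 <= block_emean S g x)%E.
Proof.
move=> g0; apply: mule_ge0.
  by apply: blk_int_ge0 => z; rewrite mule_ge0// lee_fin ltW.
rewrite lee_fin invr_ge0 fine_ge0// blk_int_ge0// => z.
by rewrite lee_fin ltW.
Qed.

Lemma measurable_block_emean S g : measurable_fun setT g ->
  measurable_fun setT (block_emean S g).
Proof.
move=> mg; apply: emeasurable_funM.
  by apply: measurable_blk_int; exact: emeasurable_funM.
by apply/measurable_EFinP; exact: (measurable_block_mass_inv S).
Qed.

Lemma block_emean_indep S g : indep_of S (block_emean S g).
Proof.
move=> i iS x y.
by rewrite /block_emean /block_mass !(@blk_int_indep _ _ S _ i iS).
Qed.

Variables (x0 : X) (Pi : {measure set X -> \bar R}) (Z : R).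
Hypothesis Z0 : 0 < Z.
Hypothesis PiT : Pi setT = 1%E.
Hypothesis PiE : forall g, measurable_fun setT g -> (forall z, 0 <= g z)%E ->
  (\int[Pi]_z g z = blk_int (enum 'I_m) (fun z => g z * (p z / Z)%:E) x0)%E.

(** With [S] integrated innermost, [h] and the mean are constants there, and the normalising mass
    cancels against the inner integral of [p]. *)
Lemma disintegration S Sc (h g : X -> \bar R) :
  perm_eq (Sc ++ S) (enum 'I_m) -> finite_mass S ->
  measurable_fun setT h -> (forall z, 0 <= h z)%E -> indep_of S h ->
  measurable_fun setT g -> (forall z, 0 <= g z)%E ->
  (\int[Pi]_x (h x * block_emean S g x) = \int[Pi]_x (h x * g x))%E.
Proof.
move=> pS fS mh h0 hS mg g0.
have w0 z : 0 <= p z / Z by rewrite divr_ge0// ltW.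
have mw : measurable_fun setT (fun z => (p z / Z)%:E).
  by apply/measurable_EFinP/measurable_funM.
have mm := measurable_block_emean S mg.
have m0 x := block_emean_ge0 S x g0.
rewrite !PiE; [|exact: emeasurable_funM|by move=> z; exact: mule_ge0
  |exact: emeasurable_funM|by move=> z; exact: mule_ge0].
rewrite -!(blk_int_perm _ _ pS); first last.
- by move=> z; apply: mule_ge0; [exact: mule_ge0|rewrite lee_fin].
- by do 2 (apply: emeasurable_funM => //).
- by move=> z; apply: mule_ge0; [exact: mule_ge0|rewrite lee_fin].
- by do 2 (apply: emeasurable_funM => //).
rewrite !blk_int_cat; apply: eq_blk_int => x.
rewrite (@eq_blk_int _ _ _ _ (fun z => (h z * block_emean S g z * Z^-1%:E) * (p
  z)%:E)%E); last first.
  by move=> z; rewrite EFinM (muleC (p z)%:E) muleA.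
rewrite blk_intM//; first last.
- by move=> z; rewrite lee_fin ltW.
- move=> z; apply: mule_ge0; first exact: mule_ge0.
  by rewrite lee_fin invr_ge0 ltW.
- by move=> i iS z y; rewrite hS// block_emean_indep.
rewrite (@eq_blk_int _ _ _ (fun z => h z * g z * (p z / Z)%:E)%E (fun z => (h z *
  Z^-1%:E) * (g z * (p z)%:E))%E); last first.
  by move=> z; rewrite EFinM (muleC (p z)%:E) !muleA; congr (_ * _)%E; rewrite -!muleA;
    congr (_ * _)%E; rewrite muleC.
rewrite (@blk_intM _ _ _ (fun z => h z * Z^-1%:E)%E)//; first last.
- by move=> z; apply: mule_ge0 => //; rewrite lee_fin ltW.
- by move=> z; apply: mule_ge0 => //; rewrite lee_fin invr_ge0 ltW.
- exact: emeasurable_funM.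
- by move=> i iS z y; rewrite hS.
rewrite -block_massE//.
rewrite -!muleA; congr (_ * _)%E.
rewrite [RHS]muleC; congr (_ * _)%E; rewrite muleCA -EFinM mulVf ?mulr1//.
by rewrite gt_eqF// block_mass_gt0.
Qed.

Section OneBlock.
Variables (S Sc : seq 'I_m).
Hypothesis pS : perm_eq (Sc ++ S) (enum 'I_m).
Hypothesis fS : finite_mass S.

Lemma bounded_block_mean (g : X -> R) M : measurable_fun setT g -> (forall x, `|g x| <=
  M) ->
  forall x, `|block_mean S g x| <= M.
Proof.
move=> mg hM x; have [Q [Q1 _ QE]] := block_kernel x fS.
rewrite QE; first exact: norm_bounded_expectation.
by apply: bounded_measurable_integrable => //; split => //; exists M.
Qed.

Lemma bounded_measurable_block_mean g : bounded_measurable g ->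
  bounded_measurable (block_mean S g).
Proof.
move=> [mg [M hM]]; split; first exact: measurable_block_mean.
by exists M; exact: bounded_block_mean.
Qed.

Lemma block_meanB_cst g c x : bounded_measurable g ->
  block_mean S (fun z => g z - c) x = block_mean S g x - c.
Proof.
move=> bg; have [Q [Q1 _ QE]] := block_kernel x fS.
have bc := @bounded_measurable_cst _ X R c.
rewrite !QE ?bounded_expectationB ?bounded_expectation_cst//.
- exact: bounded_measurable_integrable.
- by apply: bounded_measurable_integrable => //; exact: bounded_measurableB.
Qed.

Lemma block_meanE (g : X -> R) x : measurable_fun setT g -> (forall z, 0 <= g z) ->
  (exists M : R, forall z, `|g z| <= M) ->
  (block_mean S g x)%:E = block_emean S (EFin \o g) x.
Proof.
move=> mg g0 bg; have [Q [Q1 Q0 QE]] := block_kernel x fS.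
have bmg : bounded_measurable g by [].
rewrite QE; last exact: bounded_measurable_integrable.
rewrite bounded_expectationE// Q0//.
exact/measurable_EFinP.
Qed.

(** The update is the orthogonal projection onto the functions independent of [S]. *)
Lemma block_mean_adjoint f h : bounded_measurable f -> bounded_measurable h ->
  indep_of S h ->
  \int[Pi]_x (block_mean S f x * h x) = \int[Pi]_x (f x * h x).
Proof.
have pos u v : bounded_measurable u -> bounded_measurable v ->
    (forall x, 0 <= u x) -> (forall x, 0 <= v x) -> indep_of S v ->
    \int[Pi]_x (block_mean S u x * v x) = \int[Pi]_x (u x * v x).
  move=> bu bv u0 v0 vS; congr fine.
  transitivity (\int[Pi]_x ((v x)%:E * block_emean S (EFin \o u) x))%E.
    by apply: eq_integral => x _; rewrite -block_meanE ?EFinM 1?muleC//; case: bu.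
  rewrite (disintegration pS)//.
  - by apply: eq_integral => x _; rewrite EFinM muleC.
  - by apply/measurable_EFinP; case: bv.
  - exact: indep_of_comp.
  - by apply/measurable_EFinP; case: bu.
move=> bf bh hS.
have [mf [M hM]] := bf; have [mh [N hN]] := bh.
have bM := @bounded_measurable_cst _ X R M.
have bN := @bounded_measurable_cst _ X R N.
have fM x : 0 <= f x - - M by have := hM x; rewrite ler_norml opprK -lerBlDr sub0r =>
  /andP[].
have hN0 x : 0 <= h x - - N by have := hN x; rewrite ler_norml opprK -lerBlDr sub0r =>
  /andP[].
have bfM : bounded_measurable (fun x => f x - - M) by apply: bounded_measurableB => //;
  exact: bounded_measurable_cst.
have bhN : bounded_measurable (fun x => h x - - N) by apply: bounded_measurableB => //;
  exact: bounded_measurable_cst.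
have bmf := bounded_measurable_block_mean bf.
have b1 := @bounded_measurable_cst _ X R 1.
have mean : \int[Pi]_x block_mean S f x = \int[Pi]_x f x.
  have := pos _ (fun=> 1) bfM b1 fM (fun=> ler01) (fun _ _ _ _ => erefl).
  under eq_Rintegral do rewrite mulr1 block_meanB_cst//.
  under [in RHS]eq_Rintegral do rewrite mulr1.
  rewrite !bounded_expectationB//; try exact: bounded_measurable_cst.
  by move=> /addIr.
(* Adding the bounds [M] and [N] makes both factors nonnegative, as [disintegration] requires; after
   expansion the linear terms agree because the update preserves means, and only the products
   remain. *)
have := pos _ _ bfM bhN fM hN0 (indep_of_comp (fun t => t - - N) hS).
have expand u : bounded_measurable u ->
   \int[Pi]_x ((u x - - M) * (h x - - N)) = \int[Pi]_x (u x * h x) + N * \int[Pi]_x u x +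
     (M * \int[Pi]_x h x + M * N).
  move=> bu; have bMh := bounded_measurableZ M bh.
  have bMN := @bounded_measurable_cst _ X R (M * N).
  under eq_Rintegral => x _.
    rewrite (_ : _ * _ = (u x * h x + N * u x) + (M * h x + M * N)); last by ring.
    over.
  have bs := bounded_measurableD (bounded_measurableM bu bh) (bounded_measurableZ N bu).
  rewrite (bounded_expectationD PiT bs (bounded_measurableD bMh bMN)).
  rewrite (bounded_expectationD PiT (bounded_measurableM bu bh) (bounded_measurableZ N bu)).
  by rewrite (bounded_expectationD PiT bMh bMN) !bounded_expectationZ//
    bounded_expectation_cst.
under eq_Rintegral do rewrite block_meanB_cst//.
by rewrite !expand// mean => /addIr/addIr.
Qed.

Lemma block_mean_expectation f : bounded_measurable f ->
  \int[Pi]_x block_mean S f x = \int[Pi]_x f x.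
Proof.
move=> bf; have := block_mean_adjoint bf (@bounded_measurable_cst _ X R 1) (fun _ _ _ _
  => erefl).
under eq_Rintegral do rewrite mulr1.
by under [in RHS]eq_Rintegral do rewrite mulr1.
Qed.

End OneBlock.

End Gibbs.

Lemma discriminant_le (R : realType) (a b c : R) :
  0 <= c -> (forall t, 0 <= a - 2 * t * b + t ^+ 2 * c) -> b ^+ 2 <= a * c.
Proof.
move=> c0 h; have [c00|cn0] := eqVneq c 0; last first.
  have := h (b / c).
  have -> : a - 2 * (b / c) * b + (b / c) ^+ 2 * c = (a * c - b ^+ 2) / c by field.
  by rewrite pmulr_lge0 ?invr_gt0 ?lt0r ?cn0// subr_ge0.
rewrite c00 mulr0; have [->|b0] := eqVneq b 0; first by rewrite expr0n.
(* With [c = 0] the form is affine in [t]; this [t] gives it the value [- 1]. *)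
have := h ((a + 1) / (2 * b)); rewrite c00 mulr0 addr0.
have -> : a - 2 * ((a + 1) / (2 * b)) * b = - 1 by field.
by rewrite oppr_ge0 leNgt ltr01.
Qed.

(** * Alternating projections: norms of the iterates and contraction on square-integrable
    functions *)

Section AlternatingProjections.
Variables (R : realType) (m : nat) (p : m.-tuple R -> R).
Hypothesis mp : measurable_fun setT p.
Hypothesis p_gt0 : forall x, 0 < p x.
Local Notation X := (m.-tuple R).
Variables (x0 : X) (Pi : {measure set X -> \bar R}) (Z : R).
Hypothesis Z0 : 0 < Z.
Hypothesis PiT : Pi setT = 1%E.
Hypothesis PiE : forall g, measurable_fun setT g -> (forall z, 0 <= g z)%E ->
  (\int[Pi]_z g z = blk_int (enum 'I_m) (fun z => g z * (p z / Z)%:E) x0)%E.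
Variable blk : nat -> seq 'I_m.
Hypothesis blk2 : forall j, blk j.+2 = blk j.
Hypothesis perm_blk : forall j, perm_eq (blk j.+1 ++ blk j) (enum 'I_m).
Hypothesis fin_blk : forall j, finite_mass p (blk j).

Fixpoint alternate (f : X -> R) (j : nat) : X -> R :=
  if j is j'.+1 then block_mean p (blk j') (alternate f j') else f.

Lemma bounded_alternate f j : bounded_measurable f ->
  bounded_measurable (alternate f j).
Proof.
move=> bf; elim: j => //= j IH.
exact: bounded_measurable_block_mean.
Qed.

Lemma alternateB_cst f c j x : bounded_measurable f ->
  alternate (fun z => f z - c) j x = alternate f j x - c.
Proof.
move=> bf; elim: j x => //= j IH x.
rewrite -block_meanB_cst//; last exact: bounded_alternate.
by congr (block_mean _ _ _ _); apply/funext => z; exact: IH.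
Qed.

Lemma alternate_expectation f j : bounded_measurable f ->
  \int[Pi]_x alternate f j x = \int[Pi]_x f x.
Proof.
move=> bf; elim: j => //= j IH.
rewrite (block_mean_expectation mp p_gt0 Z0 PiT PiE (perm_blk j))//.
exact: bounded_alternate.
Qed.

Section Norms.
Variable f : X -> R.
Hypothesis bf : bounded_measurable f.
Let g := alternate f.
Let b j := \int[Pi]_x (g j x * g j x).

Let bg j : bounded_measurable (g j). Proof. exact: bounded_alternate. Qed.
Let bgg i j : bounded_measurable (fun x => g i x * g j x).
Proof. exact: bounded_measurableM. Qed.

Let b_ge0 j : 0 <= b j.
Proof. by apply: Rintegral_ge0 => x _; rewrite -expr2 sqr_ge0. Qed.

Let b_next j : \int[Pi]_x (g j x * g j.+1 x) = b j.+1.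
Proof.
rewrite /b /g /= (block_mean_adjoint mp p_gt0 Z0 PiT PiE (perm_blk j))//.
- by have := bg j.+1.
- exact: block_mean_indep.
Qed.

(** [g j.+3] is a projection of [g j.+2]; by adjointness the projection can be moved onto [g j.+1],
    which is already in its range because the blocks alternate with period two. *)
Let b_skip j : \int[Pi]_x (g j.+1 x * g j.+3 x) = b j.+2.
Proof.
rewrite -b_next; under eq_Rintegral do rewrite mulrC.
rewrite {1}/g /= (block_mean_adjoint mp p_gt0 Z0 PiT PiE (perm_blk _))//.
- by under eq_Rintegral do rewrite mulrC.
- by have := bg j.+2.
- by rewrite blk2; exact: block_mean_indep.
Qed.

Let b_quad i j t : \int[Pi]_x ((g i x - t * g j x) * (g i x - t * g j x)) =
  b i - 2 * t * \int[Pi]_x (g i x * g j x) + t ^+ 2 * b j.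
Proof.
under eq_Rintegral => x _.
  rewrite (_ : _ * _ = (g i x * g i x + - (2 * t) * (g i x * g j x)) + t ^+ 2 * (g j x *
    g j x)); last by ring.
  over.
have h1 := bounded_measurableZ (- (2 * t)) (bgg i j).
rewrite (bounded_expectationD PiT (bounded_measurableD (bgg i i) h1) (bounded_measurableZ
  _ (bgg j j))).
by rewrite (bounded_expectationD PiT (bgg i i) h1) !bounded_expectationZ// mulNr.
Qed.

Let b_quad_ge0 i j t : 0 <= b i - 2 * t * \int[Pi]_x (g i x * g j x) + t ^+ 2 * b j.
Proof. by rewrite -b_quad; apply: Rintegral_ge0 => x _; rewrite -expr2 sqr_ge0. Qed.

(** Cauchy-Schwarz for [g j.+1] and [g j.+3], whose inner product is [b j.+2]. The indices start at
    [1] because [f] itself need not lie in the range of either projection. *)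
Lemma alternate_logconvex j : b j.+2 ^+ 2 <= b j.+1 * b j.+3.
Proof. by apply: discriminant_le => // t; have := b_quad_ge0 j.+1 j.+3 t;
  rewrite b_skip. Qed.

Lemma alternate_norm_decay (C q : R) : 0 < q ->
  (forall j, b j.+1 <= C * q ^+ j) -> forall j, b j.+1 <= q ^+ j * b 0%N.
Proof.
move=> q0 bC; elim=> [|j IH].
  (* The case [t = 1] says [b 1 <= b 0]: a projection does not increase the norm. *)
  have := b_quad_ge0 0 1 1; rewrite b_next expr0 expr1n !mul1r; lra.
have := @logconvex_ratio_le R (fun j => b j.+1) C q (fun j => b_ge0 _)
  alternate_logconvex q0 bC j.
by move=> /le_trans; apply; rewrite exprS -mulrA ler_pM2l.
Qed.

End Norms.

Variable q : R.
Hypothesis q_gt0 : 0 < q.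
Hypothesis decay : forall f, bounded_measurable f -> exists C (a : nat -> R), forall j,
  \int[Pi]_x (alternate f j.+1 x - a j) ^+ 2 <= C * q ^+ j.

(** The [C] and the centres [a] of [decay] depend on [f] and vanish from the conclusion:
    log-convexity removes [C], and the mean is the best centre. *)
Lemma bounded_alternate_contraction f j : bounded_measurable f ->
  \int[Pi]_x (alternate f j.+1 x - \int[Pi]_x f x) ^+ 2
    <= q ^+ j * \int[Pi]_x (f x ^+ 2).
Proof.
move=> bf; set c := \int[Pi]_x f x.
have bc := @bounded_measurable_cst _ X R c.
have bfc := bounded_measurableB bf bc.
have bff := bounded_measurableM bf bf.
have altE k x : alternate f k x - c = alternate (fun z => f z - c) k x.
  by rewrite alternateB_cst.
have cen k : \int[Pi]_x alternate (fun z => f z - c) k x = 0.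
  by rewrite alternate_expectation// bounded_expectationB// bounded_expectation_cst// subrr.
have [C [a hC]] := decay bf.
(* The second moment is least around the mean, so the arbitrary centres [a k] can be replaced by
   [c]. *)
have key k : \int[Pi]_x (alternate (fun z => f z - c) k.+1 x * alternate (fun z => f z -
  c) k.+1 x) <= C * q ^+ k.
  apply: le_trans (hC k).
  set u := alternate (fun z => f z - c) k.+1.
  have bu : bounded_measurable u by exact: bounded_alternate.
  have buu := bounded_measurableM bu bu.
  under [leRHS]eq_Rintegral => x _.
    rewrite (_ : (_ - _) ^+ 2 = u x * u x + (2 * (c - a k) * u x + (c - a k) ^+ 2));
      last first.
      by rewrite /u -altE; ring.
    over.
  have bz := bounded_measurableZ (2 * (c - a k)) bu.
  have bk := @bounded_measurable_cst _ X R ((c - a k) ^+ 2).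
  rewrite (bounded_expectationD PiT buu (bounded_measurableD bz bk)).
  rewrite (bounded_expectationD PiT bz bk) bounded_expectationZ// cen mulr0 add0r.
  by rewrite bounded_expectation_cst// lerDl sqr_ge0.
under eq_Rintegral do rewrite altE expr2.
apply: le_trans (alternate_norm_decay bfc q_gt0 key j) _.
rewrite ler_pM2l ?exprn_gt0//=.
under eq_Rintegral => x _.
  rewrite (_ : _ * _ = f x * f x - (2 * c * f x - c ^+ 2)); last by ring.
  over.
have bz := bounded_measurableZ (2 * c) bf.
have bk := @bounded_measurable_cst _ X R (c ^+ 2).
rewrite (bounded_expectationB PiT bff (bounded_measurableB bz bk)).
rewrite (bounded_expectationB PiT bz bk) bounded_expectationZ// bounded_expectation_cst//
  -/c.
have -> : \int[Pi]_x (f x * f x) = \int[Pi]_x (f x ^+ 2) by apply: eq_Rintegral => x _;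
  rewrite expr2.
rewrite lerBlDr lerDl.
have -> : 2 * c * c - c ^+ 2 = c ^+ 2 by ring.
exact: sqr_ge0.
Qed.


Lemma measurable_alternate f j : measurable_fun setT f ->
  measurable_fun setT (alternate f j).
Proof. by move=> mf; elim: j => //= j IH; exact: measurable_block_mean. Qed.

Section SquareIntegrable.
Variable f : X -> R.
Hypothesis mf : measurable_fun setT f.
Hypothesis f2oo : (\int[Pi]_x (f x ^+ 2)%:E < +oo)%E.

Let trunc k x : R := Num.max (- k%:R) (Num.min (f x) k%:R).

Let bounded_trunc k : bounded_measurable (trunc k).
Proof.
split; first by apply: measurable_maxr => //; exact: measurable_minr.
exists k%:R => x; rewrite ler_norml le_max lexx/= ge_max ge_min lexx orbT andbT.
by rewrite (@le_trans _ _ 0)// oppr_le0.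
Qed.

Let norm_trunc k x : `|trunc k x| <= `|f x|.
Proof.
have k0 : 0 <= k%:R :> R by [].
have n0 := normr_ge0 (f x); have h1 := ler_norm (f x).
have h2 : - `|f x| <= f x by rewrite lerNl -normrN ler_norm.
rewrite ler_norml le_max ge_max ge_min le_min h1 h2 /=.
have h3 : - `|f x| <= k%:R by rewrite (le_trans _ k0)// oppr_le0.
have h4 : - k%:R <= `|f x| by rewrite (le_trans _ n0)// oppr_le0.
by rewrite h3 h4 orbT.
Qed.

Let cvg_trunc x : trunc k x @[k --> \oo] --> f x.
Proof.
apply: cvg_near_cst.
exists (Num.bound `|f x|) => // k /= hk; apply/eqP.
have : `|f x| <= k%:R.
  by rewrite (le_trans (ltW (archi_boundP _)))// ler_nat.
rewrite ler_norml => /andP[h1 h2].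
by rewrite /trunc (min_idPl h2) (max_idPr h1).
Qed.

(** One bound for the iterates of all truncations at once, with infinite values allowed; it is
    integrable because block means preserve [Pi]-integrals. *)
Fixpoint majorant j : X -> \bar R :=
  if j is j'.+1 then block_emean p (blk j') (majorant j')
  else fun x => `|f x|%:E.

Let majorant_ge0 j x : (0 <= majorant j x)%E.
Proof. by elim: j x => [|j IH] x /=; [rewrite lee_fin|exact: block_emean_ge0]. Qed.

Let measurable_majorant j : measurable_fun setT (majorant j).
Proof.
elim: j => /= [|j IH]; last exact: measurable_block_emean.
by apply/measurable_EFinP; exact: measurableT_comp.
Qed.

Let integral_block_emean j h : measurable_fun setT h -> (forall z, 0 <= h z)%E ->
  (\int[Pi]_x block_emean p (blk j) h x = \int[Pi]_x h x)%E.
Proof.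
move=> mh h0.
have := @disintegration _ _ p mp p_gt0 x0 Pi Z Z0 PiE (blk j) (blk j.+1) (fun=> 1%E) h
  (perm_blk j) (fin_blk j) (measurable_cst _) (fun=> lee01) (fun _ _ _ _ => erefl) mh h0.
by under eq_integral do rewrite mul1e; under [in RHS]eq_integral do rewrite mul1e.
Qed.

Let integral_majorant j : (\int[Pi]_x majorant j x < +oo)%E.
Proof.
elim: j => /= [|j IH]; last by rewrite integral_block_emean.
apply: (@le_lt_trans _ _ (\int[Pi]_x (1 + (f x ^+ 2)%:E)))%E.
  apply: ge0_le_integral => //.
  - by apply/measurable_EFinP; exact: measurableT_comp.
  - by apply/measurable_EFinP/measurable_funD => //; exact: measurable_funX.
  - move=> x _; rewrite -EFinD lee_fin -[f x ^+ 2]real_normK ?num_real//.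
    have := sqr_ge0 (`|f x| - 1); have := normr_ge0 (f x); nra.
rewrite ge0_integralD//; last 2 first.
- by move=> x _; rewrite lee_fin sqr_ge0.
- by apply/measurable_EFinP; exact: measurable_funX.
by rewrite integral_cst//= mul1e PiT lte_add_pinfty// ltry.
Qed.

Let alternate_trunc_le k j x : (`|alternate (trunc k) j x|%:E <= majorant j x)%E.
Proof.
elim: j x => /= [|j IH] x; first by rewrite lee_fin.
have bt := bounded_alternate j (bounded_trunc k).
have [Q [Q1 Q0 QE]] := block_kernel mp p_gt0 x (fin_blk j).
have it := bounded_measurable_integrable Q1 bt.
rewrite QE// /block_emean -Q0//.
apply: (@le_trans _ _ (\int[Q]_z `|(alternate (trunc k) j z)%:E|)%E).
  rewrite EFin_normr_Rintegral//; apply: le_abse_integral => //.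
  exact: measurable_int it.
apply: ge0_le_integral => //.
- by apply: measurableT_comp => //; exact: measurable_int it.
- by move=> z _; exact: IH.
Qed.

Let dominated_cvg (Q : {measure set X -> \bar R}) (u_ : nat -> X -> R) (u : X -> R)
    (H : X -> \bar R) :
  (forall k, measurable_fun setT (u_ k)) -> measurable_fun setT u ->
  {ae Q, forall x, u_ k x @[k --> \oo] --> u x} ->
  measurable_fun setT H -> (forall x, 0 <= H x)%E ->
  (\int[Q]_x H x < +oo)%E -> (forall k x, `|u_ k x|%:E <= H x)%E ->
  Q.-integrable setT (EFin \o u) /\
  \int[Q]_x u_ k x @[k --> \oo] --> \int[Q]_x u x.
Proof.
move=> mu_ mu cvu mH H0 Hoo uH.
have [] := @dominated_convergence _ _ R Q setT measurableT
  (fun k => EFin \o u_ k) (EFin \o u) H.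
- by move=> k; exact/measurable_EFinP.
- exact/measurable_EFinP.
- by apply: filterS cvu => x cx _; apply: cvg_EFin => //; exact: nearW.
- apply/integrableP; split => //.
  by rewrite (eq_integral H)// => x _; rewrite gee0_abs.
- by apply: aeW => x k _; exact: uH.
move=> iu _ cv; split => //.
apply: fine_cvg; rewrite fineK//.
exact: integrable_fin_num.
Qed.

(** Dominated convergence is applied under the conditional law [Q] at [x]. It needs the exceptional
    set of the previous step to be [Q]-null and the majorant to have a finite [Q]-mean; both hold
    for [Pi]-almost every [x]. *)
Let alternate_trunc_cvg j :
  {ae Pi, forall x, alternate (trunc k) j x @[k --> \oo] --> alternate f j x}.
Proof.
elim: j => [|j [N [mN N0 sN]]]; first exact: aeW.
have mI : measurable_fun setT (fun x => (\1_N x : R)%:E).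
  exact/measurable_EFinP/measurable_indic.
have I0 x : (0 <= (\1_N x : R)%:E)%E by rewrite lee_fin.
have a1 : {ae Pi, forall x, block_emean p (blk j) (fun x => (\1_N x)%:E) x = 0%E}.
  have mB := measurable_block_emean mp p_gt0 (blk j) mI.
  have : (\int[Pi]_x `|block_emean p (blk j) (fun x => (\1_N x)%:E) x| = 0)%E.
    under eq_integral do rewrite gee0_abs ?block_emean_ge0//.
    by rewrite integral_block_emean// integral_indic// setIT.
  by move=> /(ae_eq_integral_abs _ measurableT mB); apply: filterS => x /(_ I).
have a2 : {ae Pi, forall x, (majorant j.+1 x < +oo)%E}.
  have : Pi.-integrable setT (majorant j.+1).
    apply/integrableP; split => //.
    rewrite (eq_integral (majorant j.+1)); first exact: (integral_majorant j.+1).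
    by move=> x _; rewrite gee0_abs.
  move=> /(integrable_ae measurableT); apply: filterS => x /(_ I).
  by rewrite ge0_fin_numE.
apply: filterS2 a1 a2 => x /= x1 x2.
have [Q [Q1 Q0 QE]] := block_kernel mp p_gt0 x (fin_blk j).
have QN : Q N = 0%E.
  by rewrite -x1 /block_emean -Q0// integral_indic// setIT.
have [|||||||iu cv] := @dominated_cvg Q (fun k => alternate (trunc k) j) (alternate f j)
  (majorant j).
- by move=> k; apply: measurable_alternate; case: (bounded_trunc k).
- exact: measurable_alternate.
- by exists N.
- by [].
- by [].
- by rewrite Q0.
- by [].
rewrite QE//.
rewrite (_ : (fun k => _) = (fun k => \int[Q]_z alternate (trunc k) j z)) //.
apply/funext => k; rewrite QE//.
exact/bounded_measurable_integrable/bounded_alternate.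
Qed.

Lemma square_integrable_integrable : Pi.-integrable setT (EFin \o f).
Proof.
have [|||||||//] := @dominated_cvg Pi trunc f (majorant 0).
- by move=> k; case: (bounded_trunc k).
- by [].
- exact: aeW.
- exact: (measurable_majorant 0).
- exact: (majorant_ge0 0).
- exact: (integral_majorant 0).
- by move=> k x; rewrite lee_fin.
Qed.

Lemma alternate_contraction j :
  (\int[Pi]_x ((alternate f j.+1 x - \int[Pi]_x f x) ^+ 2)%:E
    <= (q ^+ j)%:E * \int[Pi]_x (f x ^+ 2)%:E)%E.
Proof.
pose c k := \int[Pi]_x trunc k x.
have cvc : c k @[k --> \oo] --> \int[Pi]_x f x.
  have [|||||||//] := @dominated_cvg Pi trunc f (majorant 0).
  - by move=> k; case: (bounded_trunc k).
  - by [].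
  - exact: aeW.
  - exact: (measurable_majorant 0).
  - exact: (majorant_ge0 0).
  - exact: (integral_majorant 0).
  - by move=> k x; rewrite lee_fin.
pose h k x := ((alternate (trunc k) j.+1 x - c k) ^+ 2)%:E.
have mh k : measurable_fun setT (h k).
  apply/measurable_EFinP/measurable_funX/measurable_funB => //.
  by apply: measurable_alternate; case: (bounded_trunc k).
have h0 k x : (0 <= h k x)%E by rewrite lee_fin sqr_ge0.
have -> : (\int[Pi]_x ((alternate f j.+1 x - \int[Pi]_x f x) ^+ 2)%:E =
           \int[Pi]_x limn_einf (h^~ x))%E.
  apply: ae_eq_integral => //.
  - apply/measurable_EFinP/measurable_funX/measurable_funB => //.
    exact: measurable_alternate.
  - rewrite /limn_einf; apply: measurableT_comp => //.
    by apply: measurable_fun_limn_esup => k; exact: measurableT_comp.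
  - apply: filterS (alternate_trunc_cvg j.+1) => x cx _.
    have ch : h^~ x @ \oo --> ((alternate f j.+1 x - \int[Pi]_x f x) ^+ 2)%:E.
      apply: cvg_EFin; first exact: nearW.
      have cu : (alternate (trunc k) j.+1 x - c k) @[k --> \oo] -->
          (alternate f j.+1 x - \int[Pi]_x f x) by apply: cvgB.
      rewrite expr2 (_ : fine \o _ = (fun k => (alternate (trunc k) j.+1 x - c k)
        * (alternate (trunc k) j.+1 x - c k))); first exact: cvgM.
      by apply/funext => k; rewrite -expr2.
    rewrite is_cvg_limn_einfE; last by apply/cvg_ex; eexists; exact: ch.
    exact/esym/cvg_lim.
apply: le_trans (fatou Pi measurableT mh (fun k x _ => h0 k x)) _.
have bound k : (\int[Pi]_x h k x <= (q ^+ j)%:E * \int[Pi]_x (f x ^+ 2)%:E)%E.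
  have bt := bounded_trunc k.
  have ba := bounded_alternate j.+1 bt.
  have bac := bounded_measurableB ba (@bounded_measurable_cst _ X R (c k)).
  have -> : (\int[Pi]_x h k x = (\int[Pi]_x ((alternate (trunc k) j.+1 x - c k) ^+
    2))%:E)%E.
    rewrite bounded_expectationE//.
    by under eq_fun do rewrite expr2; exact: bounded_measurableM.
  apply: (@le_trans _ _ ((q ^+ j * \int[Pi]_x (trunc k x ^+ 2))%:E)).
    by rewrite lee_fin; exact: bounded_alternate_contraction.
  rewrite EFinM lee_pmul2l// ?lte_fin ?exprn_gt0//.
  rewrite bounded_expectationE//; last first.
    by under eq_fun do rewrite expr2; exact: bounded_measurableM.
  apply: ge0_le_integral => //.
  - by move=> x _; rewrite lee_fin sqr_ge0.
  - by apply/measurable_EFinP/measurable_funX; case: bt.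
  - by apply/measurable_EFinP/measurable_funX.
  - move=> x _; rewrite lee_fin -[leLHS]ger0_norm ?sqr_ge0// -[leRHS]ger0_norm ?sqr_ge0//.
    by rewrite !normrX lerXn2r ?nnegrE.
rewrite limn_einf_lim; apply: lime_le; first exact: is_cvg_einfs.
apply: nearW => n; apply: le_trans (bound n).
by apply: ereal_inf_lbound; exists n => /=.
Qed.

End SquareIntegrable.

End AlternatingProjections.

(** * Averages against normal densities *)

Section NormalIntegrals.
Variable R : realType.
Local Notation mu := (@lebesgue_measure R).
Implicit Types (a b c e M : R) (h k : R -> R).

Lemma ge0_integral_translation (a : R) (f : R -> \bar R) :
  measurable_fun setT f -> (forall y, 0 <= f y)%E ->
  (\int[mu]_y f y = \int[mu]_y f (a + y)%R)%E.
Proof.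
move=> mf f0.
pose T (y : measurableTypeR R) : measurableTypeR R := a + y.
have mT : measurable_fun setT T by exact: measurable_funD.
have trans (A : set R) : measurable A -> mu A = pushforward mu T A.
  move=> mA; apply: (@lebesgue_measure_unique _ (pushforward mu T)) => //.
  move=> _ [[b c]] _ <-.
  rewrite /= /pushforward (_ : T @^-1` _ = `]b - a, c - a]%classic); last first.
    by apply/seteqP; split => y /=; rewrite !in_itv/= /T ltrBlDl lerBrDl.
  rewrite !lebesgue_measure_itv/= !lte_fin ltrD2r; case: ifP => // _.
  by rewrite -!EFinB; congr EFin; ring.
rewrite (eq_measure_integral (pushforward mu T)); last first.
  by move=> A mA _; exact: trans.
by rewrite ge0_integral_pushforward//= preimage_setT.
Qed.

Lemma integral_translation (a : R) (f : R -> \bar R) : measurable_fun setT f ->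
  (\int[mu]_y f y = \int[mu]_y f (a + y)%R)%E.
Proof.
move=> mf; rewrite integralE [RHS]integralE; congr (_ - _)%E.
- rewrite (ge0_integral_translation a)//; last exact: measurable_funepos.
  by apply: eq_integral => y _; rewrite !funeposE.
- rewrite (ge0_integral_translation a)//; last exact: measurable_funeneg.
  by apply: eq_integral => y _; rewrite !funenegE.
Qed.

Lemma normal_pdf_gt0 (a s y : R) : s != 0 -> 0 < normal_pdf a s y.
Proof. by move=> s0; rewrite normal_pdfE// mulr_gt0 ?expR_gt0// normal_peak_gt0. Qed.

Variable s : R.
Hypothesis s0 : s != 0.
Local Notation phi a := (normal_pdf a s).

Definition normal_avg (a : R) (h : R -> R) : R := \int[mu]_y (h y * phi a y).

Lemma integrable_normal_avg a h M : measurable_fun setT h ->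
  (forall y, `|h y| <= M) -> mu.-integrable setT (fun y => (h y * phi a y)%:E).
Proof.
move=> mh hM.
apply: (@le_integrable _ _ R mu setT measurableT _
  (fun y : measurableTypeR R => (M%:E * (phi a y)%:E)%E)).
- by apply/measurable_EFinP/measurable_funM => //; exact: measurable_normal_pdf.
- move=> y _; rewrite lee_fin !normrM [in leRHS]ger0_norm ?(le_trans _ (hM y))//.
  by rewrite ler_wpM2r.
- exact/integrableZl/integrable_normal_pdf.
Qed.

Lemma normal_avg_cst a c : normal_avg a (fun=> c) = c.
Proof.
rewrite /normal_avg RintegralZl//; last exact: integrable_normal_pdf.
by rewrite /Rintegral integral_normal_pdf mulr1.
Qed.

Lemma normal_avg_dist a h k e : measurable_fun setT h -> measurable_fun setT k ->
  (exists M : R, forall y, `|h y| <= M) -> (exists M : R, forall y, `|k y| <= M) ->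
  (forall y, `|h y - k y| <= e) -> `|normal_avg a h - normal_avg a k| <= e.
Proof.
move=> mh mk [M hM] [N kN] he.
have ih := integrable_normal_avg a mh hM.
have ik := integrable_normal_avg a mk kN.
rewrite /normal_avg -RintegralB//.
under eq_Rintegral do rewrite -mulrBl.
have mhk : measurable_fun setT (fun y => h y - k y) by exact: measurable_funB.
have ihk := integrable_normal_avg a mhk he.
apply: (le_trans (le_normr_Rintegral _ ihk)) => //.
rewrite -[leRHS](normal_avg_cst a); apply: le_Rintegral => //.
- rewrite (_ : _ \o _ = fun y => (`|h y - k y| * phi a y)%:E).
    apply: (@integrable_normal_avg _ _ e); first exact: measurableT_comp.
    by move=> y; rewrite normr_id.
  by apply/funext => y /=; rewrite normrM (@ger0_norm _ (phi a y)) ?normal_pdf_ge0.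
- exact: (@integrable_normal_avg a (fun=> e) `|e|).
- move=> y _; rewrite normrM (@ger0_norm _ (phi a y)) ?normal_pdf_ge0//.
  by rewrite ler_wpM2r ?normal_pdf_ge0.
Qed.

Lemma norm_normal_avg a h M : measurable_fun setT h -> (forall y, `|h y| <= M) ->
  `|normal_avg a h| <= M.
Proof.
move=> mh hM; have h0 : normal_avg a (fun=> 0) = 0 by exact: normal_avg_cst.
rewrite -[normal_avg a h]subr0 -h0; apply: normal_avg_dist => //.
- by exists M.
- by exists 0 => y; rewrite normr0.
- by move=> y; rewrite subr0.
Qed.

Lemma normal_avg_translate a h : measurable_fun setT h ->
  normal_avg a h = normal_avg 0 (fun y => h (a + y)).
Proof.
move=> mh; rewrite /normal_avg /Rintegral (integral_translation a); last first.
  by apply/measurable_EFinP/measurable_funM => //; exact: measurable_normal_pdf.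
congr fine; apply: eq_integral => y _; congr EFin; congr (_ * _).
by rewrite !normal_pdfE// /normal_fun subr0 addrC addKr.
Qed.

(** Synchronous coupling: both laws are driven by the same centred noise [u]. *)
Lemma normal_avg_coupling a b h k e :
  measurable_fun setT h -> measurable_fun setT k ->
  (exists M : R, forall y, `|h y| <= M) -> (exists M : R, forall y, `|k y| <= M) ->
  (forall u, `|h (a + u) - k (b + u)| <= e) -> `|normal_avg a h - normal_avg b k| <= e.
Proof.
move=> mh mk [M hM] [N kN] he.
rewrite (normal_avg_translate a)// (normal_avg_translate b)//.
apply: normal_avg_dist => //.
- by apply: measurableT_comp => //; exact: measurable_funD.
- by apply: measurableT_comp => //; exact: measurable_funD.
- by exists M.
- by exists N.
Qed.

(** Completing the square: [2 (y - a)^2 - (y - b)^2 = (y - (2 a - b))^2 - 2 (a - b)^2]. The integral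
    of the left side of the lemma is one plus the chi-square divergence, which can now be read
    off. *)
Lemma normal_pdf_sqr_div a b y :
  phi a y ^+ 2 / phi b y = expR ((a - b) ^+ 2 / s ^+ 2) * phi (2 * a - b) y.
Proof.
have pk : normal_peak s != 0 by rewrite gt_eqF// normal_peak_gt0.
rewrite !normal_pdfE// /normal_fun.
set E1 := expR _; set E2 := expR (- (y - b) ^+ 2 / _).
have E20 : E2 != 0 by rewrite gt_eqF// expR_gt0.
have -> : (normal_peak s * E1) ^+ 2 / (normal_peak s * E2) =
    normal_peak s * (E1 * E1 * E2^-1) by field; rewrite E20 pk.
rewrite [RHS]mulrCA; congr (_ * _); rewrite /E1 /E2 -expRN -!expRD; congr expR.
by field.
Qed.

(* Total variation through the chi-square divergence: with [e := d * phi b] integrate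
   [|u| <= (e + u^2 / e) / 2] for [u := phi a - phi b]. *)
Lemma normal_pdf_dist_small a b : `|a - b| <= `|s| -> a != b ->
  (\int[mu]_y `|phi a y - phi b y|%:E <= (`|a - b| * (1 + expR 1 / s ^+ 2) / 2)%:E)%E.
Proof.
move=> dab ab; set d := `|a - b|.
have d0 : 0 < d by rewrite normr_gt0 subr_eq0.
set K := expR ((a - b) ^+ 2 / s ^+ 2).
have pw y : `|phi a y - phi b y| <=
   ((d + d^-1) / 2) * phi b y + (K / (2 * d)) * phi (2 * a - b) y - d^-1 * phi a y.
  have pb := normal_pdf_gt0 b y s0.
  have -> : (d + d^-1) / 2 * phi b y + K / (2 * d) * phi (2 * a - b) y - d^-1 * phi a y =
     (d * phi b y + (phi a y - phi b y) ^+ 2 / (d * phi b y)) / 2.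
    have -> : K / (2 * d) * phi (2 * a - b) y = (K * phi (2 * a - b) y) / (2 * d) by ring.
    rewrite -normal_pdf_sqr_div; field.
    by rewrite !gt_eqF.
  rewrite ler_pdivlMr//; set u := `|_|.
  have e0 : 0 < d * phi b y by rewrite mulr_gt0.
  rewrite -[(_ - _) ^+ 2]real_normK ?num_real// -/u.
  have := sqr_ge0 (d * phi b y - u); set e := d * phi b y in e0 *.
  move=> h; rewrite -subr_ge0.
  have -> : e + u ^+ 2 / e - u * 2 = (e - u) ^+ 2 / e by field; rewrite gt_eqF.
  by rewrite divr_ge0// ?sqr_ge0// ltW.
have iphi c : mu.-integrable setT (fun y => (phi c y)%:E) by exact: integrable_normal_pdf.
apply: (@le_trans _ _ (\int[mu]_y (((d + d^-1) / 2)%:E * (phi b y)%:E + (K / (2 * d))%:E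
  * (phi (2 * a - b) y)%:E - d^-1%:E * (phi a y)%:E))%E).
  apply: ge0_le_integral => //.
  - by apply/measurable_EFinP; apply: measurableT_comp => //; apply: measurable_funB;
    exact: measurable_normal_pdf.
  - apply: emeasurable_funB; first apply: emeasurable_funD.
    + by apply: measurable_funeM; exact: (measurable_int _ (iphi _)).
    + by apply: measurable_funeM; exact: (measurable_int _ (iphi _)).
    + by apply: measurable_funeM; exact: (measurable_int _ (iphi _)).
  - move=> y _; rewrite [leRHS](_ : _ = ((d + d^-1) / 2 * phi b y +
      K / (2 * d) * phi (2 * a - b) y - d^-1 * phi a y)%:E) ?lee_fin//.
rewrite integralB//; last 2 first.
- by apply: integrableD => //; exact: integrableZl.
- exact: integrableZl.
rewrite integralD//; [|exact: integrableZl|exact: integrableZl].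
rewrite !integralZl// !integral_normal_pdf !mule1.
rewrite [leLHS](_ : _ = ((d + d^-1) / 2 + K / (2 * d) - d^-1)%:E) ?lee_fin//.
have s20 : 0 < s ^+ 2 by rewrite exprn_even_gt0.
have tE : (a - b) ^+ 2 = d ^+ 2 by rewrite real_normK ?num_real.
have t1 : (a - b) ^+ 2 / s ^+ 2 <= 1.
  rewrite ler_pdivrMr// mul1r tE -[s ^+ 2]real_normK ?num_real//.
  by rewrite lerXn2r ?nnegrE// ltW.
(* With [K = expR t] and [t <= 1]: [1 - t <= expR (- t)] gives [K - 1 <= t * K], and
   [K <= expR 1]. *)
have K1 : K - 1 <= d ^+ 2 / s ^+ 2 * expR 1.
  pose t := (a - b) ^+ 2 / s ^+ 2.
  have t0 : 0 <= t by rewrite divr_ge0 ?sqr_ge0.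
  rewrite -tE -/t (@le_trans _ _ (t * K))//; last by rewrite ler_wpM2l// ler_expR.
  have := expR_ge1Dx (- t); rewrite expRN => hK.
  have : (1 - t) * K <= 1 by rewrite -ler_pdivlMr ?expR_gt0// div1r.
  by rewrite mulrBl mul1r; lra.
have -> : (d + d^-1) / 2 + K / (2 * d) - d^-1 = (d + (K - 1) / d) / 2 by field;
  rewrite gt_eqF.
rewrite ler_pM2r ?invr_gt0// mulrDr mulr1 lerD2l ler_pdivrMr//.
by apply: le_trans K1 _; rewrite le_eqVlt; apply/orP; left; apply/eqP; ring.
Qed.

(** Within one standard deviation the chi-square bound applies; beyond it the trivial bound [2] is
    at most [2 / |s|] times the distance. [C] is the sum of both constants. *)
Lemma normal_pdf_dist : exists C : R, 0 <= C /\ forall a b,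
  (\int[mu]_y `|phi a y - phi b y|%:E <= (C * `|a - b|)%:E)%E.
Proof.
have sn0 : 0 < `|s| by rewrite normr_gt0.
have c1 : 0 <= (1 + expR 1 / s ^+ 2) / 2.
  by rewrite divr_ge0// addr_ge0// divr_ge0 ?expR_ge0 ?sqr_ge0.
have c2 : 0 <= 2 / `|s| by rewrite divr_ge0.
exists ((1 + expR 1 / s ^+ 2) / 2 + 2 / `|s|); split; first exact: addr_ge0.
move=> a b; have [->|ab] := eqVneq a b.
  by rewrite (eq_integral (cst 0%E)) ?integral0 ?subrr ?normr0 ?mulr0// => y _;
    rewrite subrr normr0.
have [dab|dab] := leP `|a - b| `|s|.
  apply: le_trans (normal_pdf_dist_small dab ab) _.
  by rewrite lee_fin mulrDl -mulrA mulrC lerDl mulr_ge0.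
apply: (@le_trans _ _ (\int[mu]_y ((phi a y)%:E + (phi b y)%:E))%E).
  apply: ge0_le_integral => //.
  - by apply/measurable_EFinP; apply: measurableT_comp => //; apply: measurable_funB;
    exact: measurable_normal_pdf.
  - by apply: emeasurable_funD; apply/measurable_EFinP; exact: measurable_normal_pdf.
  - move=> y _; rewrite -EFinD lee_fin (le_trans (ler_normB _ _))//.
    by rewrite !ger0_norm ?normal_pdf_ge0.
rewrite integralD//; [|exact: integrable_normal_pdf|exact: integrable_normal_pdf].
rewrite !integral_normal_pdf -EFinD lee_fin mulrDl.
apply: (@le_trans _ _ (2 / `|s| * `|a - b|)); last by rewrite lerDr mulr_ge0.
by rewrite mulrAC ler_pdivlMr// ler_pM2l// ltW.
Qed.

(** Passing through [normal_avg a k] separates the change of function, which costs [e], from the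
    change of mean, which is paid in total variation. *)
Lemma normal_avg_TV : exists C : R, 0 <= C /\ forall a b h k e M,
  measurable_fun setT h -> measurable_fun setT k ->
  (forall y, `|h y| <= M) -> (forall y, `|k y| <= M) ->
  (forall y, `|h y - k y| <= e) ->
  `|normal_avg a h - normal_avg b k| <= e + M * C * `|a - b|.
Proof.
have [C [C0 hC]] := normal_pdf_dist; exists C; split => //.
move=> a b h k e M mh mk hM kM he.
have M0 : 0 <= M by exact: le_trans (hM 0).
rewrite -(subrKA (normal_avg a k)) (le_trans (ler_normD _ _))// lerD//.
  by apply: normal_avg_dist => //; exists M.
rewrite /normal_avg -RintegralB//; [|exact: (integrable_normal_avg a mk kM)|exact:
  (integrable_normal_avg b mk kM)].
have iB : mu.-integrable setT (fun y => (k y * phi a y - k y * phi b y)%:E).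
  have := integrableB measurableT (integrable_normal_avg a mk kM) (integrable_normal_avg
    b mk kM).
  by apply: eq_integrable.
apply: (le_trans (le_normr_Rintegral _ iB)) => //.
rewrite -lee_fin fineK; last first.
  have := integrable_abse iB.
  by move=> /integrable_fin_num; apply.
apply: (@le_trans _ _ (\int[mu]_y (M%:E * `|phi a y - phi b y|%:E))%E).
  apply: ge0_le_integral => //.
  - apply/measurable_EFinP; apply: measurableT_comp => //.
    by have /measurable_EFinP := measurable_int _ iB.
  - apply/measurable_EFinP; apply: measurable_funM => //; apply: measurableT_comp => //.
    by apply: measurable_funB; exact: measurable_normal_pdf.
  - by move=> y _; rewrite -EFinM lee_fin -mulrBr normrM ler_wpM2r.
rewrite ge0_integralZl_EFin//; last first.
  by apply/measurable_EFinP; apply: measurableT_comp => //; apply: measurable_funB;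
    exact: measurable_normal_pdf.
by rewrite -mulrA EFinM lee_wpmul2l ?lee_fin.
Qed.

(** No moment is computed: with [t = (y - a)^2 / (4 s^2)], the inequality [t * expR (- t) <= 1]
    gives up half of the exponent and leaves a normal density of doubled variance. *)
Lemma normal_second_moment : exists B : R, 0 <= B /\ forall a,
  (\int[mu]_y (y ^+ 2 * phi a y)%:E <= (2 * a ^+ 2 + B)%:E)%E.
Proof.
pose s' := Num.sqrt 2 * s.
have s2 : s' ^+ 2 = 2 * s ^+ 2 by rewrite exprMn sqr_sqrtr.
have s'0 : s' != 0 by rewrite mulf_neq0// sqrtr_eq0 -ltNge.
have p'0 : 0 < normal_peak s' by rewrite normal_peak_gt0.
have p0 : 0 < normal_peak s by rewrite normal_peak_gt0.
pose D := 4 * s ^+ 2 * normal_peak s / normal_peak s'.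
have s20 : 0 < s ^+ 2 by rewrite exprn_even_gt0.
have D0 : 0 <= D 
  by rewrite divr_ge0 ?(ltW p'0)// mulr_ge0 ?(ltW p0)// mulr_ge0 ?(ltW s20).
have pw a y : (y - a) ^+ 2 * phi a y <= D * normal_pdf a s' y.
  rewrite !normal_pdfE// /normal_fun s2 /D.
  set t := (y - a) ^+ 2 / (4 * s ^+ 2).
  have -> : - (y - a) ^+ 2 / (s ^+ 2 *+ 2) = - t - t by rewrite /t; field.
  have -> : - (y - a) ^+ 2 / ((2 * s ^+ 2) *+ 2) = - t by rewrite /t; field.
  have -> : (y - a) ^+ 2 = 4 * s ^+ 2 * t by rewrite /t; field.
  have -> : 4 * s ^+ 2 * normal_peak s / normal_peak s' * (normal_peak s' * expR (- t))
    = 4 * s ^+ 2 * normal_peak s * expR (- t) by field; rewrite gt_eqF.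
  have -> : 4 * s ^+ 2 * t * (normal_peak s * expR (- t - t)) =
     4 * s ^+ 2 * normal_peak s * expR (- t) * (t * expR (- t)) by rewrite expRD; ring.
  rewrite ler_piMr//.
    by rewrite mulr_ge0 ?expR_ge0// mulr_ge0 ?(ltW p0)// mulr_ge0 ?(ltW s20).
  rewrite expRN ler_pdivrMr ?expR_gt0// mul1r.
  by rewrite (le_trans _ (expR_ge1Dx t))// lerDr.
exists (2 * D); split; first exact: mulr_ge0.
move=> a.
apply: (@le_trans _ _ (\int[mu]_y ((2 * a ^+ 2)%:E * (phi a y)%:E + (2 * D)%:E *
  (normal_pdf a s' y)%:E))%E).
  apply: ge0_le_integral => //.
  - by move=> y _; rewrite lee_fin mulr_ge0 ?sqr_ge0 ?normal_pdf_ge0.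
  - by apply/measurable_EFinP/measurable_funM; [exact: measurable_funX|exact:
    measurable_normal_pdf].
  - by apply: emeasurable_funD; apply: measurable_funeM; apply/measurable_EFinP;
    exact: measurable_normal_pdf.
  - move=> y _; rewrite -!EFinM -EFinD lee_fin.
    apply: (@le_trans _ _ ((2 * a ^+ 2 + 2 * (y - a) ^+ 2) * phi a y)).
      rewrite ler_wpM2r ?normal_pdf_ge0// -subr_ge0.
      have -> : 2 * a ^+ 2 + 2 * (y - a) ^+ 2 - y ^+ 2 = (y - 2 * a) ^+ 2 by ring.
      exact: sqr_ge0.
    by rewrite mulrDl lerD2l -(mulrA 2 _ (phi a y)) -(mulrA 2 D) ler_pM2l.
rewrite ge0_integralD//; first last.
- by apply: measurable_funeM; apply/measurable_EFinP; exact: measurable_normal_pdf.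
- by move=> y _; rewrite -EFinM lee_fin mulr_ge0 ?normal_pdf_ge0// mulr_ge0.
- by apply: measurable_funeM; apply/measurable_EFinP; exact: measurable_normal_pdf.
- by move=> y _; rewrite -EFinM lee_fin mulr_ge0 ?normal_pdf_ge0// mulr_ge0 ?sqr_ge0.
rewrite !ge0_integralZl_EFin//; last 6 first.
all: try by move=> y _; rewrite lee_fin normal_pdf_ge0.
all: try by apply/measurable_EFinP; exact: measurable_normal_pdf.
all: try by rewrite mulr_ge0 ?sqr_ge0.
by rewrite !integral_normal_pdf !mule1 -EFinD.
Qed.

End NormalIntegrals.

(** * The knot vector as a pinned Gaussian chain *)

Section GaussianChain.
Variables (R : realType) (m : nat) (t : R -> R -> R) (alpha s xa xb : R).
Hypothesis s_gt0 : 0 < s.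
Hypothesis alpha_gt0 : 0 < alpha.
Hypothesis alpha_le1 : alpha <= 1.
Hypothesis tE : forall a y, t a y = normal_pdf (alpha * a) s y.
Local Notation X := (m.-tuple R).
Local Notation mu := (@lebesgue_measure R).
Local Notation kv := (@knot_val R m xa xb).
Implicit Types (x y z : X) (i j : 'I_m) (S : seq 'I_m).

Definition chain_dens (x : X) : R := \prod_(k < m.+1) t (kv x k) (kv x k.+1).

Let s_neq0 : s != 0. Proof. by rewrite gt_eqF. Qed.

Lemma knot_val_tnth x i : kv x i.+1 = tnth x i.
Proof.
by rewrite /knot_val/= eqSS ltn_eqF ?ltn_ord// (tnth_nth 0).
Qed.

Lemma knot_val_set_coord x i v k :
  kv (set_coord x i v) k = if k == i.+1 then v else kv x k.
Proof.
have [->|ki] := eqVneq k i.+1.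
  by rewrite knot_val_tnth tnth_set_coord eqxx.
case: k ki => // k ki.
have kvS z : kv z k.+1 = if k == m then xb else nth 0 z k by [].
rewrite !kvS; case: ifP => // _; have [lt|ge] := ltnP k m; last first.
  by rewrite !nth_default ?size_tuple.
rewrite -[k]/(nat_of_ord (Ordinal lt)) -!tnth_nth tnth_set_coord.
by case: eqP => // h; move: ki; rewrite -h /= eqxx.
Qed.

Lemma measurable_knot_val k : measurable_fun setT (fun x => kv x k).
Proof.
rewrite /knot_val; case: k => [|k] /=; first exact: measurable_cst.
case: (k.+1 == m.+1); first exact: measurable_cst.
have [lt|ge] := ltnP k m; last first.
  rewrite (_ : (fun x => _) = cst 0); first exact: measurable_cst.
  by apply/funext => x; rewrite nth_default// size_tuple.
rewrite (_ : (fun x => _) = (fun x => tnth x (Ordinal lt))).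
  exact: measurable_tnth.
by apply/funext => x; rewrite (tnth_nth 0).
Qed.

Lemma measurable_normal_pdf2 (u v : X -> R) (c : R) : c != 0 ->
  measurable_fun setT u -> measurable_fun setT v ->
  measurable_fun setT (fun x => normal_pdf (u x) c (v x)).
Proof.
move=> c0 mu_ mv.
rewrite (_ : (fun x => _) = (fun x => normal_peak c * expR (- (v x - u x) ^+ 2 / (c ^+ 2
  *+ 2)))); last first.
  by apply/funext => x; rewrite normal_pdfE.
apply: measurable_funM => //; apply: measurableT_comp => //.
apply: measurable_funM => //; apply: measurableT_comp => //.
by apply: measurable_funX; exact: measurable_funB.
Qed.

Let measurable_t k : measurable_fun setT (fun x => t (kv x k) (kv x k.+1)).
Proof.
under eq_fun do rewrite tE.
apply: measurable_normal_pdf2 => //; last exact: measurable_knot_val.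
by apply: measurable_funM => //; exact: measurable_knot_val.
Qed.

Lemma measurable_chain_dens : measurable_fun setT chain_dens.
Proof. by rewrite /chain_dens; apply: measurable_prod => k _. Qed.

Lemma chain_dens_gt0 x : 0 < chain_dens x.
Proof. by apply: prodr_gt0 => k _; rewrite tE normal_pdf_gt0. Qed.

Definition cond_coef : R := alpha / (1 + alpha ^+ 2).
Definition cond_sd : R := s / Num.sqrt (1 + alpha ^+ 2).
Definition cond_mean i x : R := cond_coef * (kv x i + kv x i.+2).
Definition cond_dens i x : R := normal_pdf (cond_mean i x) cond_sd (tnth x i).

Let a2_gt0 : 0 < 1 + alpha ^+ 2. Proof. by rewrite ltr_wpDr ?sqr_ge0. Qed.

Lemma cond_sd_neq0 : cond_sd != 0.
Proof. by rewrite mulf_neq0// invr_neq0// gt_eqF// sqrtr_gt0. Qed.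

Lemma cond_coef_ge0 : 0 <= cond_coef.
Proof. by rewrite divr_ge0 ?ltW. Qed.

Lemma cond_coef_le : cond_coef <= 2^-1.
Proof.
rewrite ler_pdivrMr// mulrC ler_pdivlMr// -subr_ge0.
have -> : 1 + alpha ^+ 2 - alpha * 2 = (alpha - 1) ^+ 2 by ring.
exact: sqr_ge0.
Qed.

(** Completing the square in the middle point: [E] is the two-step transition density from [a] to
    [b], and the normal factor is the law of the middle point given both ends. *)
Lemma two_step_dens (a b : R) : exists E : R, 0 < E /\ forall y : R,
  t a y * t y b = E * normal_pdf (cond_coef * (a + b)) cond_sd y.
Proof.
have sd0 := cond_sd_neq0.
have a2n0 : 1 + alpha ^+ 2 != 0 by rewrite gt_eqF.
have p1 : 0 < normal_peak cond_sd by rewrite normal_peak_gt0.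
have p0 : 0 < normal_peak s by rewrite normal_peak_gt0.
exists (normal_peak s ^+ 2 / normal_peak cond_sd
  * expR (- (b - alpha ^+ 2 * a) ^+ 2 / (2 * s ^+ 2 * (1 + alpha ^+ 2)))); split.
  by rewrite mulr_gt0 ?expR_gt0// divr_gt0// exprn_gt0.
move=> y; rewrite !tE !normal_pdfE// /normal_fun.
rewrite mulrACA -expRD -expr2.
have -> : cond_sd ^+ 2 = s ^+ 2 / (1 + alpha ^+ 2).
  by rewrite expr_div_n sqr_sqrtr// ltW.
rewrite [RHS]mulrACA -expRD divfK ?gt_eqF//; congr (_ * expR _).
by rewrite /cond_coef; field; rewrite s_neq0 a2n0.
Qed.

(** Cross-multiplied form of the fact that the chain density divided by [cond_dens i] does not
    depend on coordinate [i]; only the two transition factors at that site are affected. *)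
Lemma single_site x i v :
  chain_dens (set_coord x i v) * cond_dens i x =
  chain_dens x * normal_pdf (cond_mean i x) cond_sd v.
Proof.
have i0 : (i < m.+1)%N by rewrite ltnS ltnW.
pose k0 : 'I_m.+1 := Ordinal i0.
have i1 : (i.+1 < m.+1)%N by rewrite ltnS.
pose k1 : 'I_m.+1 := Ordinal i1.
have k10 : k1 != k0 by rewrite -val_eqE /= gtn_eqF.
have [E [_ hE]] := two_step_dens (kv x i) (kv x i.+2).
have split z : chain_dens z = (t (kv z i) (kv z i.+1) * t (kv z i.+1) (kv z i.+2))
    * \prod_(k < m.+1 | (k != k0) && (k != k1)) t (kv z k) (kv z k.+1).
  by rewrite /chain_dens (bigD1 k0)//= (bigD1 k1)//= mulrA.
rewrite !split !knot_val_set_coord eqxx ltn_eqF// gtn_eqF// !hE.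
rewrite [\prod_(k < m.+1 | _) t (kv (set_coord _ _ _) k) _](_ : _ =
    \prod_(k < m.+1 | (k != k0) && (k != k1)) t (kv x k) (kv x k.+1)); last first.
  apply: eq_bigr => k /andP[kk0 kk1]; rewrite !knot_val_set_coord eqSS.
  by rewrite -!val_eqE/= in kk0 kk1; rewrite (negbTE kk0) (negbTE kk1).
rewrite /cond_dens /cond_mean knot_val_tnth; ring.
Qed.

Lemma measurable_cond_mean i : measurable_fun setT (cond_mean i).
Proof.
by apply: measurable_funM => //; apply: measurable_funD; exact: measurable_knot_val.
Qed.

Lemma measurable_cond_dens i : measurable_fun setT (cond_dens i).
Proof.
apply: measurable_normal_pdf2; first exact: cond_sd_neq0.
- exact: measurable_cond_mean.
- exact: measurable_tnth.
Qed.

Lemma cond_dens_gt0 i x : 0 < cond_dens i x.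
Proof. by rewrite normal_pdf_gt0// cond_sd_neq0. Qed.

(* Sites of equal parity are never adjacent. *)
Lemma cond_mean_set_coord x i j v : odd i = odd j ->
  cond_mean j (set_coord x i v) = cond_mean j x.
Proof.
move=> ij; rewrite /cond_mean !knot_val_set_coord.
have h1 : (nat_of_ord j == i.+1) = false.
  by apply/eqP => h; move: ij; rewrite h/=; case: (odd i).
have h2 : (j.+2 == i.+1) = false.
  by apply/eqP => -[h]; move: ij; rewrite -h/=; case: (odd j).
by rewrite h1 h2.
Qed.

Lemma cond_dens_set_coord x i j v : odd i = odd j -> i != j ->
  cond_dens j (set_coord x i v) = cond_dens j x.
Proof.
move=> ij nij; rewrite /cond_dens cond_mean_set_coord// tnth_set_coord.
by rewrite eq_sym (negbTE nij).
Qed.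

Definition same_parity (b : bool) S := uniq S /\ forall i, i \in S -> odd i = b.

Lemma same_parity_cons b i S : same_parity b (i :: S) ->
  [/\ odd i = b, i \notin S & same_parity b S].
Proof.
move=> [/= /andP[iS uS] hS]; split => //; first by apply: hS; rewrite inE eqxx.
by split => // j jS; apply: hS; rewrite inE jS orbT.
Qed.

(** For a block of equal parity this is the unnormalised marginal density of the coordinates outside
    [S]. *)
Definition outer_dens S x : R := chain_dens x / \prod_(i <- S) cond_dens i x.

Lemma outer_dens_gt0 S x : 0 < outer_dens S x.
Proof.
by rewrite divr_gt0 ?chain_dens_gt0// prodr_gt0// => i _; exact: cond_dens_gt0.
Qed.

Lemma outer_dens_indep b S : same_parity b S -> indep_of S (outer_dens S).
Proof.
move=> [uS pS] i iS x v; rewrite /outer_dens !(bigD1_seq i)//=.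
rewrite [X in _ / (_ * X) = _](_ : _ = \prod_(j <- S | j != i) cond_dens j x); last first.
  rewrite big_seq_cond [RHS]big_seq_cond; apply: eq_bigr => j /andP[jS ji].
  by rewrite cond_dens_set_coord// ?(pS i)// ?(pS j)// eq_sym.
have pr0 : \prod_(j <- S | j != i) cond_dens j x != 0.
  by rewrite gt_eqF// prodr_gt0// => j _; exact: cond_dens_gt0.
have cn z : cond_dens i z != 0 by rewrite gt_eqF// cond_dens_gt0.
apply/eqP; rewrite eqr_div ?mulf_neq0//; apply/eqP.
have e : cond_dens i (set_coord x i v) = normal_pdf (cond_mean i x) cond_sd v.
  by rewrite /cond_dens cond_mean_set_coord// tnth_set_coord eqxx.
by rewrite !mulrA single_site e.
Qed.

(** Resamples the sites one after another. Conditional means at sites of equal parity do not see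
    each other, so this is the joint update of a block. *)
Fixpoint site_avg S (g : X -> R) (x : X) : R :=
  if S is i :: S' then
    \int[mu]_v (site_avg S' g (set_coord x i v) * cond_dens i (set_coord x i v))
  else g x.

Lemma site_avgE i S g x : site_avg (i :: S) g x =
  normal_avg cond_sd (cond_mean i x) (fun v => site_avg S g (set_coord x i v)).
Proof.
rewrite /normal_avg /=; apply: eq_Rintegral => v _; congr (_ * _).
by rewrite /cond_dens cond_mean_set_coord// tnth_set_coord eqxx.
Qed.

Lemma bounded_site_avg S (g : X -> R) M : measurable_fun setT g ->
  (forall x, `|g x| <= M) ->
  measurable_fun setT (site_avg S g) /\ forall x, `|site_avg S g x| <= M.
Proof.
move=> mg hM; elim: S => [//|i S [IH1 IH2]]; split.
  apply: measurableT_comp => //; apply: (@measurable_integral_coord _ _ i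
    (fun z => (site_avg S g z * cond_dens i z)%:E)).
  by apply/measurable_EFinP/measurable_funM => //; exact: measurable_cond_dens.
move=> x; rewrite site_avgE; apply: norm_normal_avg => //.
exact: (measurableT_comp IH1 (measurable_set_coordr x i)).
Qed.

Lemma site_avg_cst S c x : site_avg S (fun=> c) x = c.
Proof.
elim: S x => // i S IH x; rewrite site_avgE.
transitivity (normal_avg cond_sd (cond_mean i x) (fun=> c)); last exact: normal_avg_cst.
by congr normal_avg; apply/funext => v; exact: IH.
Qed.

(** Peeling off site [i] leaves [outer_dens] constant in that coordinate and produces the factor
    [cond_dens i], the weight of the single-site average. *)
Lemma blk_int_site_avg b S g x : same_parity b S -> bounded_measurable g ->
  blk_int S (fun z => (g z * chain_dens z)%:E) x =
  (outer_dens S x * site_avg S g x)%:E.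
Proof.
move=> pS [mg [M hM]]; elim: S x pS => [|i S IH] x pS.
  by rewrite /= /outer_dens big_nil divr1 mulrC.
have [pi iS pS'] := same_parity_cons pS.
have oi := outer_dens_indep pS.
have cn z : cond_dens i z != 0 by rewrite gt_eqF// cond_dens_gt0.
have outer_cons z : outer_dens S z = outer_dens (i :: S) z * cond_dens i z.
  by rewrite /outer_dens big_cons invfM mulrA mulrAC divfK.
have [ma ba] := bounded_site_avg S mg hM.
rewrite [LHS]/=; under eq_integral => v _.
  rewrite IH// outer_cons oi ?inE ?eqxx// mulrAC -mulrA EFinM.
  over.
have iav : mu.-integrable setT (fun v => (site_avg S g (set_coord x i v) * cond_dens i
  (set_coord x i v))%:E).
  rewrite (_ : (fun v => _) = (fun v : measurableTypeR R => (site_avg S g (set_coord x i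
    v) * normal_pdf (cond_mean i x) cond_sd v)%:E)); last first.
    by apply/funext => v; rewrite /cond_dens cond_mean_set_coord// tnth_set_coord eqxx.
  apply: (@integrable_normal_avg _ cond_sd (cond_mean i x) _ M) => //.
  exact: (measurableT_comp ma (measurable_set_coordr x i)).
rewrite integralZl// [RHS]EFinM.
have e : (site_avg (i :: S) g x)%:E = (\int[mu]_v
    (site_avg S g (set_coord x i v) * cond_dens i (set_coord x i v))%:E)%E.
  by rewrite fineK//; exact: integrable_fin_num.
by rewrite e.
Qed.

Lemma finite_mass_parity b S : same_parity b S -> finite_mass chain_dens S.
Proof.
move=> pS x.
have := blk_int_site_avg x pS (@bounded_measurable_cst _ X R 1).
by under eq_blk_int do rewrite mul1r; move=> ->; rewrite ltry.
Qed.

Lemma block_mean_site_avg b S g x : same_parity b S -> bounded_measurable g ->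
  block_mean chain_dens S g x = site_avg S g x.
Proof.
move=> pS bg; rewrite /block_mean /block_mass (blk_int_site_avg x pS bg)/=.
have := blk_int_site_avg x pS (@bounded_measurable_cst _ X R 1).
under eq_blk_int do rewrite mul1r.
move=> ->; rewrite /= site_avg_cst mulr1 mulrAC divff ?mul1r// gt_eqF//.
exact: outer_dens_gt0.
Qed.


(* These weights are superharmonic for the averaging of neighbours,
   [(w (k - 1) + w (k + 1)) / 2 = w k - 1], so the update of the means contracts the
   sup norm weighted by [w]. *)
Definition knot_weight (k : nat) : R := k%:R * (m.+1%:R - k%:R).
Definition contraction_rate : R := 1 - 4 / m.+1%:R ^+ 2.

Lemma knot_weight_ge0 k : (k <= m.+1)%N -> 0 <= knot_weight k.
Proof. by move=> km; rewrite mulr_ge0// subr_ge0 ler_nat. Qed.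

Lemma knot_weight_ge1 i : 1 <= knot_weight i.+1.
Proof.
rewrite /knot_weight -natrB; last by rewrite ltnS ltnW.
by rewrite -natrM ler1n muln_gt0 subn_gt0 /= ltnS ltn_ord.
Qed.

(** The mean falls short of the weight by exactly [1], which is at least [4 / (m + 1)^2] times the
    weight because the parabola is at most [(m + 1)^2 / 4]. *)
Lemma knot_weight_mean i :
  2^-1 * (knot_weight i + knot_weight i.+2) <= contraction_rate * knot_weight i.+1.
Proof.
have m0 : 0 < m.+1%:R ^+ 2 :> R by rewrite exprn_gt0.
have -> : 2^-1 * (knot_weight i + knot_weight i.+2) = knot_weight i.+1 - 1.
  by rewrite /knot_weight -[i.+2]addn2 -[i.+1]addn1 !natrD; field.
rewrite /contraction_rate mulrBl mul1r lerD2l lerN2 mulrAC ler_pdivrMr// mul1r.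
rewrite -subr_ge0 /knot_weight.
have -> : m.+1%:R ^+ 2 - 4 * (i.+1%:R * (m.+1%:R - i.+1%:R)) =
    (m.+1%:R - 2 * i.+1%:R) ^+ 2 :> R by ring.
exact: sqr_ge0.
Qed.

Definition close_on (b : bool) (D : R) (x y : X) :=
  forall i, odd i = b -> `|tnth x i - tnth y i| <= D * knot_weight i.+1.

Lemma cond_mean_dist b i D x y : 0 <= D -> odd i = b -> close_on (~~ b) D x y ->
  `|cond_mean i x - cond_mean i y| <= contraction_rate * D * knot_weight i.+1.
Proof.
move=> D0 ib cl.
(* Coordinate [i] is knot [i.+1], so knots and coordinates have opposite parities. At the end knots
   [0] and [m.+1] both vectors take the same value. *)
have kd k : (k <= m.+1)%N -> odd k = b -> `|kv x k - kv y k| <= D * knot_weight k.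
  move=> km kb; have w0 := knot_weight_ge0 km.
  case: k km kb w0 => [|k] km kb w0; first by rewrite subrr normr0 mulr_ge0.
  have [lt|ge] := ltnP k m.
    have := cl (Ordinal lt); rewrite -!knot_val_tnth/=; apply.
    by rewrite -kb /= negbK.
  have -> : k = m by apply/eqP; rewrite eqn_leq ge -ltnS km.
  by rewrite /knot_val /= eqxx subrr normr0 /knot_weight subrr !mulr0.
rewrite /cond_mean -mulrBr normrM (ger0_norm cond_coef_ge0).
have -> : kv x i + kv x i.+2 - (kv y i + kv y i.+2) =
  (kv x i - kv y i) + (kv x i.+2 - kv y i.+2) by ring.
apply: (@le_trans _ _ (2^-1 * (D * knot_weight i + D * knot_weight i.+2))).
  apply: ler_pM => //; [exact: cond_coef_ge0|exact: cond_coef_le|].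
  rewrite (le_trans (ler_normD _ _))// lerD// kd//= ?negbK// ?ltnS//.
  exact/leqW/ltnW.
rewrite -mulrDr mulrCA [contraction_rate * D]mulrC -mulrA.
by rewrite ler_wpM2l// knot_weight_mean.
Qed.

(** As [close_on b] ignores the other parity, the case [D = 0] forces [g] to depend only on the
    coordinates of parity [b]. *)
Definition knot_lipschitz b L (g : X -> R) :=
  forall x y D, 0 <= D -> close_on b D x y -> `|g x - g y| <= L * D.

Lemma close_on_set_coord b D x y i u v : odd i = ~~ b -> close_on b D x y ->
  close_on b D (set_coord x i u) (set_coord y i v).
Proof.
move=> ib cl j jb; rewrite !tnth_set_coord; case: eqP => [ji|_]; last exact: cl.
by move: ib; rewrite -ji jb; case: b {cl jb}.
Qed.

Section ParityBlock.
Variables (b : bool) (S : seq 'I_m).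
Hypothesis pS : same_parity b S.
Hypothesis allS : forall i, odd i = b -> i \in S.
Hypothesis rate_ge0 : 0 <= contraction_rate.

Let avg_slice (g : X -> R) S' x i : bounded_measurable g ->
  measurable_fun setT (fun v : R => site_avg S' g (set_coord x i v)).
Proof.
move=> [mg [M hM]]; have [ma _] := bounded_site_avg S' mg hM.
exact: (measurableT_comp ma (measurable_set_coordr x i)).
Qed.

(** Under the synchronous coupling, resampled coordinates differ exactly by the difference of their
    means, which [cond_mean_dist] contracts. *)
Lemma site_avg_contraction L g : bounded_measurable g -> knot_lipschitz b L g ->
  knot_lipschitz (~~ b) (contraction_rate * L) (site_avg S g).
Proof.
move=> bg lg x y D D0 cl.
have [mg [M hM]] := bg.
(* Generalisation to a partly processed block: the sites of parity [b] outside [S'] have been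
   resampled and are at the contracted distance. *)
suff key S' : same_parity b S' -> forall x y, close_on (~~ b) D x y ->
    (forall i, odd i = b -> i \notin S' ->
      `|tnth x i - tnth y i| <= contraction_rate * D * knot_weight i.+1) ->
    `|site_avg S' g x - site_avg S' g y| <= contraction_rate * L * D.
  by apply: key => // i ib; rewrite allS.
elim: S' {x y cl} => [|i S' IH] pS' x y cl out.
  rewrite mulrAC [_ * L]mulrC; apply: lg; first exact: mulr_ge0.
  by move=> i ib; exact: out.
have [ib iS' pS''] := same_parity_cons pS'.
rewrite !site_avgE; apply: normal_avg_coupling; first exact: cond_sd_neq0.
- exact: avg_slice.
- exact: avg_slice.
- by exists M => v; exact: (bounded_site_avg S' mg hM).2.
- by exists M => v; exact: (bounded_site_avg S' mg hM).2.
move=> u; apply: IH => //.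
- by apply: close_on_set_coord => //; rewrite negbK.
- move=> j jb jS'; rewrite !tnth_set_coord; case: eqP => [ji|/eqP ji].
    have -> : cond_mean i x + u - (cond_mean i y + u) = cond_mean i x - cond_mean i y by
      ring.
    by rewrite ji; exact: cond_mean_dist ib cl.
  by apply: out => //; rewrite inE (negbTE ji).
Qed.

Lemma indep_of_agree T (h : X -> T) S' x y : indep_of S' h ->
  (forall i, i \notin S' -> tnth x i = tnth y i) -> h x = h y.
Proof.
elim: S' x => [|i S' IH] x hS' out.
  by congr h; apply: eq_from_tnth => i; exact: out.
rewrite -(hS' i _ x (tnth y i)) ?inE ?eqxx//.
apply: IH => [|j jS']; first exact: indep_of_cons hS'.
rewrite tnth_set_coord; case: eqP => [->//|/eqP ji].
by apply: out; rewrite inE (negbTE ji).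
Qed.

(** Here resampled coordinates are made equal and the difference of their laws is paid in total
    variation, once per site; this suits a merely bounded [g]. *)
Lemma site_avg_smoothing Sc g : bounded_measurable g ->
  (forall i, odd i = ~~ b -> i \in Sc) -> indep_of Sc g ->
  exists L, 0 <= L /\ knot_lipschitz (~~ b) L (site_avg S g).
Proof.
move=> bg pSc gSc.
have [C [C0 hC]] := normal_avg_TV cond_sd_neq0.
have [mg [M hM]] := bg.
have M0 : 0 <= M by exact: le_trans (hM (zero_tuple R m)).
(* The cost of one site per unit of [D]: sup bound, total variation constant, and largest shift of a
   mean, with the weight bounded crudely by [(m + 1)^2]. *)
pose A := M * C * (contraction_rate * m.+1%:R ^+ 2).
have A0 : 0 <= A by rewrite !mulr_ge0// sqr_ge0.
have wle i : knot_weight i.+1 <= m.+1%:R ^+ 2.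
  rewrite expr2 /knot_weight ler_pM// ?subr_ge0 ?ler_nat// ?gerBl//.
  - by rewrite ltnW// ltnS.
  - by rewrite ltnW// ltnS.
exists ((size S)%:R * A); split; first exact: mulr_ge0.
move=> x y D D0 cl.
suff key S' : same_parity b S' -> forall x y, close_on (~~ b) D x y ->
    (forall i, odd i = b -> i \notin S' -> tnth x i = tnth y i) ->
    `|site_avg S' g x - site_avg S' g y| <= (size S')%:R * A * D.
  by apply: key => // i ib; rewrite allS.
elim: S' {x y cl} => [|i S' IH] pS' x y cl out.
  rewrite mul0r mul0r /= (@indep_of_agree _ g Sc x y)// ?subrr ?normr0//.
  move=> i iSc; apply: out => //; apply/eqP; apply: contraNT iSc => ib.
  by apply: pSc; move: ib; case: (b); case: (odd i).
have [ib iS' pS''] := same_parity_cons pS'.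
rewrite !site_avgE.
apply: (le_trans (hC _ _ _ _ ((size S')%:R * A * D) M _ _ _ _ _)).
- exact: avg_slice.
- exact: avg_slice.
- by move=> v; exact: (bounded_site_avg S' mg hM).2.
- by move=> v; exact: (bounded_site_avg S' mg hM).2.
- move=> v; apply: IH => //.
    by apply: close_on_set_coord => //; rewrite negbK.
  move=> j jb jS'; rewrite !tnth_set_coord; case: eqP => [//|/eqP ji].
  by apply: out => //; rewrite inE (negbTE ji).
rewrite /= -natr1 mulrDl mulrDl mul1r lerD2l.
apply: (@le_trans _ _ (M * C * (contraction_rate * D * knot_weight i.+1))).
  by rewrite ler_wpM2l ?mulr_ge0//; exact: cond_mean_dist ib cl.
rewrite /A -(mulrA (M * C)) ler_wpM2l ?mulr_ge0//.
by rewrite -!(mulrA contraction_rate) ler_wpM2l// [leRHS]mulrC ler_wpM2l.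
Qed.

End ParityBlock.

Definition walk_dens (n : nat) x : R := \prod_(k < n) t (kv x k) (kv x k.+1).
(** The summand [1] makes the energy dominate constants, so that one bound gives finite mass and
    finite second moments. *)
Definition energy (n : nat) x : R := 1 + \sum_(k < n.+1) kv x k ^+ 2.

Lemma walk_dens_ge0 n x : 0 <= walk_dens n x.
Proof. by apply: prodr_ge0 => k _; rewrite tE normal_pdf_ge0. Qed.

Lemma energy_ge1 n x : 1 <= energy n x.
Proof. by rewrite lerDl sumr_ge0// => k _; exact: sqr_ge0. Qed.

Lemma energy_ge0 n x : 0 <= energy n x.
Proof. exact: le_trans (energy_ge1 n x). Qed.

Lemma measurable_energy n : measurable_fun setT (energy n).
Proof.
apply: measurable_funD => //; apply: measurable_sum => k.
by apply: measurable_funX; exact: measurable_knot_val.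
Qed.

Lemma measurable_walk_dens n : measurable_fun setT (walk_dens n).
Proof. by apply: measurable_prod => k _. Qed.

Lemma energy_set_coord x i v : energy i.+1 (set_coord x i v) = energy i x + v ^+ 2.
Proof.
rewrite /energy big_ord_recr/= knot_val_set_coord eqxx addrA; congr (1 + _ + _).
by apply: eq_bigr => k _; rewrite knot_val_set_coord ltn_eqF.
Qed.

Lemma walk_dens_set_coord x i v : walk_dens i.+1 (set_coord x i v) =
  walk_dens i x * normal_pdf (alpha * kv x i) s v.
Proof.
rewrite /walk_dens big_ord_recr/= !knot_val_set_coord eqxx ltn_eqF// tE.
congr (_ * _); apply: eq_bigr => k _.
by rewrite !knot_val_set_coord eqSS !ltn_eqF// ltnS ltnW.
Qed.

(** Coordinates are integrated out from the last one backwards, each against its own transition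
    density; the final transition to [xT] is absent from [walk_dens m]. *)
Lemma walk_energy_bound d : (d <= m)%N -> exists C : R, 0 <= C /\ forall x,
  (blk_int (drop (m - d) (enum 'I_m)) (fun z => (energy m z * walk_dens m z)%:E) x
   <= (C * (energy (m - d) x * walk_dens (m - d) x))%:E)%E.
Proof.
elim: d => [_|d IH dm].
  by exists 1; split => // x; rewrite subn0 drop_oversize ?size_enum_ord// mul1r.
have [C [C0 hC]] := IH (ltnW dm).
have [B [B0 hB]] := normal_second_moment s_neq0.
have jm : (m - d.+1 < m)%N by rewrite ltn_subrL (leq_ltn_trans _ dm).
pose i : 'I_m := Ordinal jm.
have jS : (m - d)%N = i.+1 by rewrite /= subnSK.
(* In [3 + B], one unit is the old energy, two come from [2 * a ^+ 2] with [a ^+ 2 <= e], and [B] is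
   absorbed because [1 <= e]. *)
exists (C * (3 + B)); split; first by rewrite mulr_ge0// addr_ge0.
move=> x; rewrite (drop_nth i) ?size_enum_ord//.
have -> : nth i (enum 'I_m) (m - d.+1) = i by apply/val_inj; rewrite /= nth_enum_ord.
rewrite subnSK// in hC *.
set e := energy (m - d.+1) x; set w := walk_dens (m - d.+1) x.
have e1 : 1 <= e by exact: energy_ge1.
have e0 : 0 <= e by exact: le_trans e1.
have w0 : 0 <= w by exact: walk_dens_ge0.
set a := alpha * kv x i.
have a2e : a ^+ 2 <= e.
  rewrite /a exprMn (@le_trans _ _ (kv x i ^+ 2))//.
    by rewrite ler_piMl ?sqr_ge0// expr_le1// ltW.
  rewrite /e /energy big_ord_recr/= addrA lerDr addr_ge0// sumr_ge0// => k _.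
  exact: sqr_ge0.
have mE : measurable_fun setT (fun z => (energy m z * walk_dens m z)%:E).
  by apply/measurable_EFinP/measurable_funM; [exact: measurable_energy|exact:
    measurable_walk_dens].
have mphi : measurable_fun setT (fun v : R => (normal_pdf a s v)%:E).
  by apply/measurable_EFinP; exact: measurable_normal_pdf.
have mv2 : measurable_fun setT (fun v : R => (v ^+ 2 * normal_pdf a s v)%:E).
  by apply/measurable_EFinP/measurable_funM; [exact: measurable_funX|exact:
    measurable_normal_pdf].
apply: (@le_trans _ _ (\int[mu]_v ((C * w)%:E *
    (e%:E * (normal_pdf a s v)%:E + (v ^+ 2 * normal_pdf a s v)%:E)))%E).
  rewrite /=; apply: ge0_le_integral => //.
  - by move=> v _; apply: blk_int_ge0 => z; rewrite lee_fin mulr_ge0 ?energy_ge0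
    ?walk_dens_ge0.
  - exact: measurable_blk_slice.
  - by apply: measurable_funeM; apply: emeasurable_funD => //; exact: measurable_funeM.
  - move=> v _; apply: le_trans (hC _) _.
    rewrite jS energy_set_coord walk_dens_set_coord -/e -/w -/a.
    rewrite [leRHS](_ : _ = (C * w * (e * normal_pdf a s v +
      v ^+ 2 * normal_pdf a s v))%:E)// lee_fin.
    by rewrite le_eqVlt; apply/orP; left; apply/eqP; ring.
rewrite ge0_integralZl_EFin//; first last.
- by rewrite mulr_ge0.
- by apply: emeasurable_funD => //; exact: measurable_funeM.
- move=> v _; rewrite -EFinM -EFinD lee_fin.
  by apply: addr_ge0; apply: mulr_ge0; rewrite ?sqr_ge0 ?normal_pdf_ge0.
rewrite ge0_integralD//; first last.
- by move=> v _; rewrite lee_fin mulr_ge0 ?sqr_ge0 ?normal_pdf_ge0.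
- exact: measurable_funeM.
- by move=> v _; rewrite -EFinM lee_fin mulr_ge0 ?normal_pdf_ge0.
rewrite ge0_integralZl_EFin//; last first.
  by move=> v _; rewrite lee_fin normal_pdf_ge0.
rewrite integral_normal_pdf mule1.
apply: (@le_trans _ _ ((C * w)%:E * (e%:E + (2 * a ^+ 2 + B)%:E))%E).
  by rewrite lee_wpmul2l ?lee_fin ?mulr_ge0// leeD2l.
rewrite -EFinD -EFinM lee_fin.
rewrite [leRHS](_ : _ = C * w * ((3 + B) * e)); last by ring.
rewrite ler_wpM2l ?mulr_ge0//.
have : B <= B * e by rewrite ler_peMr.
by rewrite mulrDl; lra.
Qed.

(** The final transition to [xT] is at most the peak of its normal density, and the walk without it
    has finite energy. *)
Lemma chain_energy_finite x :
  (blk_int (enum 'I_m) (fun z => (energy m z * chain_dens z)%:E) x < +oo)%E.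
Proof.
have [C [C0 hC]] := walk_energy_bound (leqnn m).
have mE : measurable_fun setT (fun z => (energy m z * walk_dens m z)%:E).
  by apply/measurable_EFinP/measurable_funM; [exact: measurable_energy|exact:
    measurable_walk_dens].
have pk : 0 <= normal_peak s by exact: normal_peak_ge0.
apply: (@le_lt_trans _ _ (blk_int (enum 'I_m) (fun z => (normal_peak s)%:E * (energy m z
  * walk_dens m z)%:E) x)%E).
  apply: le_blk_int.
  - by apply/measurable_EFinP/measurable_funM; [exact: measurable_energy|exact:
    measurable_chain_dens].
  - exact: measurable_funeM.
  - by move=> z; rewrite lee_fin mulr_ge0 ?energy_ge0// ltW// chain_dens_gt0.
  - move=> z; rewrite -EFinM lee_fin /chain_dens big_ord_recr/= -/(walk_dens m z).
    rewrite mulrA mulrC tE ler_wpM2r ?normal_pdf_ub// mulr_ge0 ?energy_ge0//.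
    exact: walk_dens_ge0.
rewrite (@blk_intM _ _ _ (fun=> (normal_peak s)%:E))//; last first.
  by move=> z; rewrite lee_fin mulr_ge0 ?energy_ge0 ?walk_dens_ge0.
have := hC x; rewrite subnn drop0 => h.
rewrite lte_mul_pinfty ?lee_fin//.
exact: le_lt_trans h (ltry _).
Qed.

End GaussianChain.

(** * The rate of the checkerboard sampler and the blocking cost *)

Section RateBound.
Variables (R : realType) (m : nat) (tdens : R -> R -> R -> R) (x0 xT T alpha s : R).
Hypothesis m_ge2 : (2 <= m)%N.
Hypothesis s_gt0 : 0 < s.
Hypothesis alpha_gt0 : 0 < alpha.
Hypothesis alpha_le1 : alpha <= 1.
Hypothesis tdensE : forall a y, tdens (delta T m) a y = normal_pdf (alpha * a) s y.
Local Notation X := (m.-tuple R).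
Local Notation p := (@chain_dens R m (tdens (delta T m)) x0 xT).
Local Notation c := (@contraction_rate R m).
Local Notation E := (@energy R m x0 xT m).

Let mp : measurable_fun setT p := measurable_chain_dens x0 xT s_gt0 tdensE.
Let p_gt0 : forall x, 0 < p x := chain_dens_gt0 x0 xT s_gt0 tdensE.

(** At [m = 1] the rate would be [0]; the divisions by [c ^+ 2] below call for two knots. *)
Let c_gt0 : 0 < c.
Proof.
rewrite subr_gt0 ltr_pdivrMr ?exprn_gt0// mul1r -natrX ltr_nat.
by rewrite (@leq_trans (3 ^ 2))// leq_exp2r.
Qed.

Let c_le1 : c <= 1.
Proof. by rewrite gerBl divr_ge0. Qed.

(** The operator [U_odd (U_even g)] applies the even block first although the chain updates the odd
    one first; hence [blk 0] is the even block. *)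
Let blk j : seq 'I_m := if odd j then odd_block m else even_block m.

Let blk_parity j : same_parity (~~ odd j) (blk j).
Proof.
rewrite /blk /same_parity; case: (odd j) => /=; split.
- exact: filter_uniq (enum_uniq _).
- by move=> i; rewrite mem_filter => /andP[/negbTE].
- exact: filter_uniq (enum_uniq _).
- by move=> i; rewrite mem_filter => /andP[].
Qed.

Let mem_blk j (i : 'I_m) : odd i = ~~ odd j -> i \in blk j.
Proof.
by rewrite /blk; case: (odd j) => /= oi; rewrite mem_filter oi mem_enum.
Qed.

Let blk2 j : blk j.+2 = blk j. Proof. by rewrite /blk/= negbK. Qed.

Let perm_blk j : perm_eq (blk j.+1 ++ blk j) (enum 'I_m).
Proof.
have h : perm_eq (even_block m ++ odd_block m) (enum 'I_m).
  exact/permPl/perm_filterC.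
by rewrite /blk /=; case: (odd j) => //=; rewrite perm_catC.
Qed.

Let fin_blk j : finite_mass p (blk j).
Proof. exact: (finite_mass_parity x0 xT s_gt0 tdensE (blk_parity j)). Qed.

Let zero : X := zero_tuple R m.

Let fin_enum : finite_mass p (enum 'I_m).
Proof.
move=> x; apply: le_lt_trans (chain_energy_finite x0 xT s_gt0 alpha_gt0 alpha_le1 tdensE x).
apply: le_blk_int.
- exact/measurable_EFinP.
- by apply/measurable_EFinP/measurable_funM => //; exact: measurable_energy.
- by move=> z; rewrite lee_fin ltW.
- by move=> z; rewrite lee_fin ler_peMl ?energy_ge1// ltW.
Qed.

Let Z := @knot_Z R tdens x0 xT T m.

Let Z_gt0 : 0 < Z. Proof. exact: (block_mass_gt0 mp p_gt0 zero fin_enum). Qed.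

Lemma stationary_measure : exists Pi : {measure set X -> \bar R}, [/\ Pi setT = 1%E,
  (forall g, measurable_fun setT g -> (forall z, 0 <= g z)%E ->
    (\int[Pi]_z g z = blk_int (enum 'I_m) (fun z => g z * (p z / Z)%:E) zero)%E) &
  (forall f, Pi.-integrable setT (EFin \o f) ->
    pi_int tdens x0 xT T f = (\int[Pi]_z (f z)%:E)%E)].
Proof.
have [||Pi [Pi0 Pi1]] := @blk_int_measure R m (enum 'I_m) (fun z => p z / Z) zero.
- exact: measurable_funM.
- by move=> z; rewrite divr_ge0// ltW.
exists Pi; split => //.
- rewrite -[Pi setT]mul1e -integral_cst// Pi0//.
  rewrite (@eq_blk_int _ _ _ _ (fun z => Z^-1%:E * (p z)%:E)%E); last first.
    by move=> z; rewrite mul1e -EFinM mulrC.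
  rewrite (@blk_intM _ _ _ (fun=> Z^-1%:E))//.
  + by rewrite -(block_massE p_gt0 zero fin_enum) -EFinM mulVf// gt_eqF.
  + exact/measurable_EFinP.
  + by move=> z; rewrite lee_fin invr_ge0 ltW.
  + by move=> z; rewrite lee_fin ltW.
- move=> f fi; rewrite Pi1//; apply: eq_blk_int => z.
  by rewrite -EFinM mulrA.
Qed.

Section WithStationary.
Variable Pi : {measure set X -> \bar R}.
Hypothesis PiT : Pi setT = 1%E.
Hypothesis PiE : forall g, measurable_fun setT g -> (forall z, 0 <= g z)%E ->
    (\int[Pi]_z g z = blk_int (enum 'I_m) (fun z => g z * (p z / Z)%:E) zero)%E.
Hypothesis PiI : forall f, Pi.-integrable setT (EFin \o f) ->
    pi_int tdens x0 xT T f = (\int[Pi]_z (f z)%:E)%E.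

Let alt := alternate p blk.

Let bounded_alt f j : bounded_measurable f -> bounded_measurable (alt f j).
Proof. exact: (bounded_alternate mp p_gt0 fin_blk). Qed.

Let energy_finite : (\int[Pi]_x (E x)%:E < +oo)%E.
Proof.
have mE : measurable_fun setT (fun x => (E x)%:E).
  by apply/measurable_EFinP; exact: measurable_energy.
have E0 x : (0 <= (E x)%:E)%E by rewrite lee_fin energy_ge0.
rewrite PiE//.
rewrite (@eq_blk_int _ _ _ _ (fun z => Z^-1%:E * (E z * p z)%:E)%E); last first.
  by move=> z; rewrite -!EFinM; congr EFin; ring.
rewrite (@blk_intM _ _ _ (fun=> Z^-1%:E))//.
- rewrite lte_mul_pinfty ?lee_fin ?invr_ge0 ?ltW//.
  exact: (chain_energy_finite x0 xT s_gt0 alpha_gt0 alpha_le1 tdensE).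
- by apply/measurable_EFinP/measurable_funM => //; exact: measurable_energy.
- by move=> z; rewrite lee_fin invr_ge0 ltW.
- by move=> z; rewrite lee_fin mulr_ge0 ?energy_ge0// ltW.
Qed.

Let lipschitz_alt f : bounded_measurable f ->
  exists L, 0 <= L /\ forall j, knot_lipschitz (~~ odd j) (c ^+ j * L) (alt f j.+2).
Proof.
move=> bf.
have altE j : alt f j.+1 = site_avg alpha s x0 xT (blk j) (alt f j).
  apply/funext => x.
  exact: (block_mean_site_avg x0 xT s_gt0 tdensE x (blk_parity j) (bounded_alt j bf)).
(* Smoothing requires an input independent of the other block, which holds after one half sweep; the
   Lipschitz bound therefore starts at index [2]. *)
have [|L [L0 hL]] := @site_avg_smoothing R m alpha s x0 xT s_gt0 alpha_gt0
   (~~ odd 1) (blk 1) (blk_parity 1) (fun i => @mem_blk 1 i) (ltW c_gt0)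
   (blk 0) (alt f 1) (bounded_alt 1 bf) (fun i => @mem_blk 0 i).
  exact: block_mean_indep.
exists L; split => //; elim=> [|j IH]; first by rewrite expr0 mul1r altE.
rewrite altE exprS -mulrA.
have := @site_avg_contraction R m alpha s x0 xT s_gt0 alpha_gt0
   (~~ odd j.+2) (blk j.+2) (blk_parity j.+2) (fun i => @mem_blk j.+2 i) (ltW c_gt0)
   (c ^+ j * L) (alt f j.+2) (bounded_alt j.+2 bf).
rewrite /= !negbK; apply.
exact: IH.
Qed.

Let decay f : bounded_measurable f -> exists C (a : nat -> R), forall j,
  \int[Pi]_x (alt f j.+1 x - a j) ^+ 2 <= C * (c ^+ 2) ^+ j.
Proof.
move=> bf; have [L [L0 hL]] := lipschitz_alt bf.
have [_ [M hM]] := bounded_alt 1 bf.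
have M0 : 0 <= M by exact: le_trans (hM zero).
pose E2 := fine (\int[Pi]_x (E x)%:E)%E.
have E20 : 0 <= E2.
  by rewrite fine_ge0// integral_ge0// => x _; rewrite lee_fin energy_ge0.
have E2E : E2%:E = (\int[Pi]_x (E x)%:E)%E.
  by rewrite fineK// ge0_fin_numE// integral_ge0// => x _; rewrite lee_fin energy_ge0.
have q0 : 0 < c ^+ 2 by rewrite exprn_gt0.
have bsq j a : bounded_measurable (fun x => (alt f j.+1 x - a) ^+ 2).
  under eq_fun do rewrite expr2.
  by apply: bounded_measurableM; apply: bounded_measurableB => //;
     [exact: bounded_alt|exact: bounded_measurable_cst|exact: bounded_alt|exact:
       bounded_measurable_cst].
(* [M ^+ 2] serves [j = 0], before the Lipschitz bound sets in; the division by [c ^+ 2] makes up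
   for its lag of one half sweep. *)
exists (M ^+ 2 + L ^+ 2 * E2 / c ^+ 2).
(* Centred at its value at the origin, an iterate is at most its Lipschitz constant times
   [Num.sqrt (E x)], which bounds every coordinate and, the weights being at least [1], the weighted
   distance. *)
exists (fun j => if j is j'.+1 then alt f j.+1 zero else 0) => j.
have t1 : 0 <= M ^+ 2 by exact: sqr_ge0.
have t2 : 0 <= L ^+ 2 * E2 / c ^+ 2 by rewrite divr_ge0 ?sqr_ge0// mulr_ge0 ?sqr_ge0.
case: j => [|j].
  rewrite expr0 mulr1 (@le_trans _ _ (M ^+ 2))// ?lerDl//.
  rewrite -[leRHS](bounded_expectation_cst PiT); apply: le_bounded_expectation => //.
  - exact: bounded_measurable_cst.
  - move=> x; rewrite subr0 -[alt _ _ _ ^+ 2]real_normK ?num_real//.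
    by rewrite lerXn2r ?nnegrE.
rewrite (@le_trans _ _ ((c ^+ j * L) ^+ 2 * E2))//; last first.
  rewrite mulrDl -[leLHS]add0r lerD//; first by rewrite mulr_ge0// exprn_ge0// ltW.
  rewrite exprMn [(c ^+ 2) ^+ _]exprS exprAC.
  by rewrite le_eqVlt; apply/orP; left; apply/eqP; field; rewrite gt_eqF.
rewrite -lee_fin bounded_expectationE// EFinM E2E.
rewrite -ge0_integralZl_EFin//.
- apply: ge0_le_integral => //.
  + by move=> x _; rewrite lee_fin sqr_ge0.
  + by apply/measurable_EFinP; case: (bsq j.+1 (alt f j.+2 zero)).
  + by apply: measurable_funeM; apply/measurable_EFinP; exact: measurable_energy.
  + move=> x _; rewrite -EFinM lee_fin -[leLHS]real_normK ?num_real//.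
    rewrite -[X in _ <= _ * X](sqr_sqrtr (energy_ge0 x0 xT m x)) -exprMn.
    rewrite lerXn2r ?nnegrE// ?mulr_ge0 ?exprn_ge0 ?sqrtr_ge0// ?(ltW c_gt0)//.
    apply: (hL j) => [|i _]; first exact: sqrtr_ge0.
    rewrite tnth_mktuple subr0 (@le_trans _ _ (Num.sqrt (E x)))//; last first.
      by rewrite ler_peMr ?sqrtr_ge0// knot_weight_ge1.
    rewrite -sqrtr_sqr ler_sqrt ?energy_ge0//.
    rewrite /energy -(knot_val_tnth x0 xT).
    have im : (i.+1 < m.+1)%N by rewrite ltnS.
    rewrite (bigD1 (Ordinal im))//= addrCA lerDl addr_ge0// sumr_ge0// => k _.
    exact: sqr_ge0.
- by move=> x _; rewrite lee_fin energy_ge0.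
- by apply/measurable_EFinP; exact: measurable_energy.
- exact: sqr_ge0.
Qed.

Let checker_iter n (f : X -> R) : iter n (@checker_P R tdens x0 xT T m) f = alt f n.*2.
Proof. by elim: n => //= n ->; rewrite /alt/= /blk /= odd_double. Qed.

(** The squared norm loses a factor [c ^+ 2] per half sweep, and a sweep has two. *)
Lemma contraction_rate_mem : L2_rate_set tdens x0 xT T m (c ^+ 4).
Proof.
move=> f [mf f2oo] r hr.
have pi0 (g : X -> R) : measurable_fun setT g -> (forall z, 0 <= g z) ->
    pi_int tdens x0 xT T g = (\int[Pi]_z (g z)%:E)%E.
  move=> mg g0; rewrite PiE//; last exact/measurable_EFinP.
  by apply: eq_blk_int => z; rewrite -EFinM mulrA.
have q0 : 0 < c ^+ 2 by rewrite exprn_gt0.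
have f2 : (\int[Pi]_x (f x ^+ 2)%:E < +oo)%E.
  by rewrite -pi0//; [exact: measurable_funX|move=> z; exact: sqr_ge0].
have fi : Pi.-integrable setT (EFin \o f).
  exact: (square_integrable_integrable mp p_gt0 Z_gt0 PiT PiE perm_blk fin_blk mf f2).
rewrite (PiI fi) -/(Rintegral Pi setT f).
set mean := Rintegral Pi setT f.
have main j := @alternate_contraction R m p mp p_gt0 zero Pi Z Z_gt0 PiT PiE blk blk2
  perm_blk fin_blk (c ^+ 2) q0 decay f mf f2 j.
have malt n : measurable_fun setT (fun x => (alt f n x - mean) ^+ 2).
  by apply: measurable_funX; apply: measurable_funB => //; exact: measurable_alternate.
pose F := fine (\int[Pi]_x (f x ^+ 2)%:E)%E.
have FE : F%:E = (\int[Pi]_x (f x ^+ 2)%:E)%E.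
  by rewrite fineK// ge0_fin_numE// integral_ge0// => x _; rewrite lee_fin sqr_ge0.
have F0 : 0 <= F by rewrite fine_ge0// integral_ge0// => x _; rewrite lee_fin sqr_ge0.
have start : (\int[Pi]_x ((f x - mean) ^+ 2)%:E <= (2 * F + 2 * mean ^+ 2)%:E)%E.
  apply: (@le_trans _ _ (\int[Pi]_x (2%:E * (f x ^+ 2)%:E + (2 * mean ^+ 2)%:E))%E).
    apply: ge0_le_integral => //.
    - by move=> x _; rewrite lee_fin sqr_ge0.
    - by apply/measurable_EFinP; exact: (malt 0%N).
    - apply: emeasurable_funD => //; apply: measurable_funeM.
      by apply/measurable_EFinP; exact: measurable_funX.
    - move=> x _; rewrite -EFinM -EFinD lee_fin -subr_ge0.
      have -> : 2 * f x ^+ 2 + 2 * mean ^+ 2 - (f x - mean) ^+ 2 = (f x + mean) ^+ 2 by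
        ring.
      exact: sqr_ge0.
  rewrite ge0_integralD//.
  - rewrite ge0_integralZl_EFin//.
    + by rewrite -FE integral_cst//= PiT mule1.
    + by move=> x _; rewrite lee_fin sqr_ge0.
    + by apply/measurable_EFinP; exact: measurable_funX.
  - by move=> x _; rewrite mule_ge0 ?lee_fin ?sqr_ge0.
  - by apply: measurable_funeM; apply/measurable_EFinP; exact: measurable_funX.
  - by move=> x _; rewrite lee_fin mulr_ge0 ?sqr_ge0.
have hB : 0 <= 2 * F + 2 * mean ^+ 2 by rewrite addr_ge0// mulr_ge0// sqr_ge0.
have Fq0 : 0 <= F / c ^+ 2 by rewrite divr_ge0// sqr_ge0.
have r0 : 0 < r by apply: lt_trans hr; rewrite exprn_gt0.
exists (2 * F + 2 * mean ^+ 2 + F / c ^+ 2 + 1); split.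
  by rewrite ltr_wpDl// addr_ge0.
move=> n; rewrite pi0; last 2 first.
- by rewrite checker_iter; exact: malt.
- by move=> z; exact: sqr_ge0.
(* For [n = 0] the bound is [start]. Of the [n.+1] sweeps only [n.*2.+1] half sweeps contract, and
   the missing one is paid by [F / c ^+ 2]. *)
rewrite checker_iter; case: n => [|n].
  by apply: le_trans start _; rewrite lee_fin expr0 mulr1 -addrA lerDl addr_ge0.
apply: (@le_trans _ _ (((c ^+ 2) ^+ n.*2.+1 * F)%:E)).
  by rewrite EFinM FE; exact: (main n.*2.+1).
rewrite lee_fin (@le_trans _ _ (F / c ^+ 2 * r ^+ n.+1))//; last first.
  by rewrite ler_pM2r ?exprn_gt0//; lra.
have -> : (c ^+ 2) ^+ n.*2.+1 * F = F / c ^+ 2 * (c ^+ 4) ^+ n.+1.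
  have -> : (c ^+ 4) ^+ n.+1 = (c ^+ 2) ^+ n.*2.+1 * c ^+ 2.
    by rewrite (exprM c 2 2) -exprM mul2n doubleS exprSr.
  by field; rewrite gt_eqF.
rewrite ler_wpM2l// lerXn2r ?nnegrE ?exprn_ge0 ?(ltW c_gt0) ?(ltW r0)//.
exact: ltW.
Qed.

End WithStationary.

Lemma relax_time_bound :
  `|relax_time tdens x0 xT T m| <= m.+1%:R ^+ 2 / 4.
Proof.
have [Pi [PiT PiE PiI]] := stationary_measure.
have mem := contraction_rate_mem PiT PiE PiI.
set A := L2_rate_set tdens x0 xT T m in mem.
have m0 : 0 < m.+1%:R ^+ 2 :> R by rewrite exprn_gt0.
rewrite /relax_time /rho_mT -/A.
(* For a nonpositive infimum, including the default [0] of a set without one, [ln] and its inverse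
   are [0] by convention, and so is the relaxation time. *)
have [le0|gt0] := leP (inf A) 0.
  by rewrite ln0// invr0 oppr0 normr0 divr_ge0// ltW.
have infc : inf A <= c ^+ 4.
  have [hi|hi] := pselect (has_inf A); first exact: (ge_inf hi.2).
  by move: gt0; rewrite inf_out// ltxx.
(* Giving up a constant factor in the time, this lets [ln x <= x - 1] yield the bound at once. *)
have c4 : c ^+ 4 <= c by rewrite -[leRHS]expr1 ler_wiXn2l// (ltW c_gt0).
have lnle : ln (inf A) <= - (4 / m.+1%:R ^+ 2).
  have := @le_ln1Dx R (inf A - 1); rewrite addrCA subrr addr0 => h.
  apply: (le_trans (h _)); first by rewrite ltrBrDl subrr.
  rewrite lerBlDr (le_trans infc)// (le_trans c4)//.
  by rewrite /contraction_rate addrC.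
have d0 : 0 < 4 / m.+1%:R ^+ 2 :> R by rewrite divr_gt0.
rewrite normrN normfV ltr0_norm; last by rewrite (le_lt_trans lnle)// oppr_lt0.
rewrite -[leRHS]invrK lef_pV2 ?posrE ?invr_gt0 ?divr_gt0//.
- by rewrite invf_div lerNr.
- by rewrite oppr_gt0 (le_lt_trans lnle)// oppr_lt0.
Qed.

Lemma C_blocking_bound (Crej : R -> R) (K : R) : 0 <= T ->
  0 <= Crej (2 * T / m.+1%:R) -> Crej (2 * T / m.+1%:R) <= K * (2 * T / m.+1%:R) ->
  `|C_blocking tdens x0 xT Crej T m| <= K / 2 * T * m.+1%:R ^+ 2.
Proof.
move=> T0 C0 CK; rewrite /C_blocking !normrM (ger0_norm C0) (@ger0_norm _ m%:R)//.
have m0 : m.+1%:R != 0 :> R by rewrite pnatr_eq0.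
apply: (@le_trans _ _ (m.+1%:R ^+ 2 / 4 * m.+1%:R * (K * (2 * T / m.+1%:R)))).
  have h : `|relax_time tdens x0 xT T m| * m%:R <= m.+1%:R ^+ 2 / 4 * m.+1%:R.
    by apply: ler_pM; rewrite ?relax_time_bound ?ler_nat.
  by apply: ler_pM; rewrite ?mulr_ge0.
by rewrite le_eqVlt; apply/orP; left; apply/eqP; field; rewrite nat1r.
Qed.

End RateBound.

(** * Growth of the number of knots and of the cost *)

Section Asymptotics.
Variable R : realType.

(** [2 / c1 <= T] secures two knots; in [c1 + 2] one unit is the rounding up and one the successor,
    both absorbed because the power of [T] is at least [1]. *)
Lemma m_of_T_bounds (c1 chi T : R) : 0 < c1 -> 0 <= chi -> 1 <= T -> 2 / c1 <= T ->
  [/\ (2 <= m_of_T c1 chi T)%N, c1 * T `^ (1 + chi) <= (m_of_T c1 chi T)%:R &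
      (m_of_T c1 chi T).+1%:R <= (c1 + 2) * T `^ (1 + chi)].
Proof.
move=> c0 chi0 T1 Tc.
have T0 : 0 < T by exact: lt_le_trans T1.
have TP : T <= T `^ (1 + chi).
  by rewrite -[leLHS]powRr1 ?(ltW T0)// ler_powR// lerDl.
have P1 : 1 <= T `^ (1 + chi) by exact: le_trans TP.
set y := c1 * T `^ (1 + chi).
have y2 : 2 <= y.
  rewrite /y mulrC -ler_pdivrMr//; exact: le_trans TP.
have y0 : 0 < y by exact: lt_le_trans y2.
have mE : (m_of_T c1 chi T)%:R = (Num.ceil y)%:~R :> R.
  rewrite /m_of_T -/y natr_absz ger0_norm//.
  by rewrite ceil_ge0 (lt_trans _ y0)// ltrN10.
have ym : y <= (m_of_T c1 chi T)%:R by rewrite mE ceil_ge.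
have my : (m_of_T c1 chi T)%:R < y + 1.
  by have := ceilB1_lt y; rewrite mE intrB ltrBlDr.
split => //.
- by rewrite -(ler_nat R) (le_trans y2).
- rewrite -natr1 mulrDl -/y; have := ltW my; lra.
Qed.

Lemma bigO_pow_blocking (Cb : R -> R) (K c1 chi T1 : R) :
  0 < c1 -> 0 <= chi -> 0 <= K ->
  (forall T, T1 <= T -> 1 <= T -> 2 / c1 <= T ->
     `|Cb T| <= K / 2 * T * (m_of_T c1 chi T).+1%:R ^+ 2) ->
  bigO_pow Cb (3 + 2 * chi).
Proof.
move=> c0 chi0 K0 h.
exists (K / 2 * (c1 + 2) ^+ 2); exists (Num.max T1 (Num.max 1 (2 / c1))) => T.
rewrite !ge_max => /and3P[hT1 T1' Tc].
have T0 : 0 < T by exact: lt_le_trans T1'.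
have [_ _ hm] := m_of_T_bounds c0 chi0 T1' Tc.
apply: le_trans (h T hT1 T1' Tc) _.
have -> : K / 2 * (c1 + 2) ^+ 2 * T `^ (3 + 2 * chi) =
    K / 2 * T * ((c1 + 2) * T `^ (1 + chi)) ^+ 2.
  have -> : 3 + 2 * chi = 1 + ((1 + chi) + (1 + chi)) by ring.
  rewrite powRD; last by rewrite (lt0r_neq0 T0) implybT.
  rewrite [T `^ (_ + _ + _)]powRD; last by rewrite (lt0r_neq0 T0) implybT.
  by rewrite powRr1 ?(ltW T0)//; ring.
rewrite ler_wpM2l// ?mulr_ge0 ?(ltW T0)//.
by rewrite lerXn2r ?nnegrE// ?mulr_ge0 ?powR_ge0// addr_ge0// ltW.
Qed.

End Asymptotics.

Theorem theorem1 (R : realType) :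
  (* case (b): Ornstein--Uhlenbeck bridge *)
  (forall (theta sigma x0 xT : R) (Crej : R -> R) (K t0 c1 chi1 : R),
     0 < theta -> 0 < sigma ->
     (forall t, 0 < t -> 0 < Crej t) ->
     0 < K -> 0 < t0 -> (forall t, 0 < t -> t <= t0 -> Crej t <= K * t) ->
     0 < c1 -> 0 < chi1 ->
     bigO_pow (fun T => C_blocking (ou_tdens theta sigma) x0 xT Crej T
                                   (m_of_T c1 chi1 T))
              (3 + 2 * chi1)) /\
  (* case (a): scaled Brownian bridge, including chi1 = 0 *)
  (forall (sigma x0 xT : R) (Crej : R -> R) (c5 c1 chi1 : R),
     0 < sigma -> 0 < c5 -> (forall t, 0 < t -> Crej t = c5 * t) ->
     0 < c1 -> 0 <= chi1 ->
     bigO_pow (fun T => C_blocking (bm_tdens sigma) x0 xT Crej T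
                                   (m_of_T c1 chi1 T))
              (3 + 2 * chi1)).
Proof.
split.
- move=> theta sigma x0 xT Crej K t0 c1 chi th0 sg0 Cpos K0 t00 CK c10 chi0.
  (* From this threshold on [2 T / (m + 1) <= t0], since [m >= c1 T^(1 + chi)] makes the step shrink
     like [T^(- chi)]; this is where [chi > 0] enters. *)
  apply: (@bigO_pow_blocking R _ K c1 chi ((2 / (c1 * t0)) `^ chi^-1)) => //.
  + exact: ltW.
  + exact: ltW.
  move=> T hT T1 Tc; have [m2 ym _] := m_of_T_bounds c10 (ltW chi0) T1 Tc.
  set m := m_of_T c1 chi T in m2 ym *.
  have T0 : 0 < T by exact: lt_le_trans T1.
  have d0 : 0 < delta T m by rewrite divr_gt0.
  have e1 (u : R) : 0 < u -> expR (- u) < 1 by move=> u0; rewrite expR_lt1 oppr_lt0.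
  have v0 : 0 < sigma ^+ 2 * (1 - expR (- (2 * theta * delta T m))) / (2 * theta).
    rewrite divr_gt0 ?mulr_gt0 ?exprn_gt0 ?subr_gt0 ?e1 ?mulr_gt0//.
  have tm0 : 0 < 2 * T / m.+1%:R by rewrite divr_gt0// mulr_gt0.
  apply: (@C_blocking_bound R m (ou_tdens theta sigma) x0 xT T
    (expR (- (theta * delta T m)))
    (Num.sqrt (sigma ^+ 2 * (1 - expR (- (2 * theta * delta T m))) / (2 * theta)))) => //.
  + by rewrite sqrtr_gt0.
  + exact: expR_gt0.
  + by rewrite ltW// e1// mulr_gt0.
  + by move=> a y; rewrite /ou_tdens mulrC.
  + exact: ltW.
  + exact/ltW/Cpos.
  + apply: CK => //.
    have hP : 2 / (c1 * t0) <= T `^ chi.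
      have b0 : 0 < 2 / (c1 * t0) by rewrite divr_gt0// mulr_gt0.
      have -> : 2 / (c1 * t0) = (2 / (c1 * t0)) `^ chi^-1 `^ chi.
        by rewrite -powRrM mulVf ?lt0r_neq0// powRr1// ltW.
      by apply: ge0_ler_powR; rewrite ?nnegrE ?powR_ge0 ?(ltW chi0) ?(ltW T0).
    have TT : T `^ (1 + chi) = T * T `^ chi.
      by rewrite powRD ?powRr1 ?(ltW T0)// (lt0r_neq0 T0) implybT.
    rewrite ler_pdivrMr// (@le_trans _ _ (t0 * m%:R))//; last first.
      by rewrite ler_pM2l// ler_nat.
    apply: (@le_trans _ _ (t0 * (c1 * T `^ (1 + chi)))); last by rewrite ler_pM2l.
    have h : 2 <= T `^ chi * (c1 * t0) by rewrite -ler_pdivrMr ?mulr_gt0.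
    have -> : t0 * (c1 * T `^ (1 + chi)) = T `^ chi * (c1 * t0) * T.
      by rewrite TT; ring.
    by rewrite ler_wpM2r// ltW.
- move=> sigma x0 xT Crej c5 c1 chi sg0 c50 CE c10 chi0.
  (* The cost is linear at every length, so the step need not shrink and [chi = 0] is allowed. *)
  apply: (@bigO_pow_blocking R _ c5 c1 chi 0) => //; first exact: ltW.
  move=> T _ T1 Tc; have [m2 _ _] := m_of_T_bounds c10 chi0 T1 Tc.
  set m := m_of_T c1 chi T in m2 *.
  have T0 : 0 < T by exact: lt_le_trans T1.
  have d0 : 0 < delta T m by rewrite divr_gt0.
  have tm0 : 0 < 2 * T / m.+1%:R by rewrite divr_gt0// mulr_gt0.
  apply: (@C_blocking_bound R m (bm_tdens sigma) x0 xT T 1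
    (sigma * Num.sqrt (delta T m))) => //.
  + by rewrite mulr_gt0// sqrtr_gt0.
  + by move=> a y; rewrite /bm_tdens mul1r.
  + exact: ltW.
  + by rewrite CE// mulr_ge0// ltW.
  + by rewrite CE.
Qed.
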